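(* On trees (and on general graphs) the mending radius and the existential mending volume are distinct: for every integer $k\ge1$ there is an LCL problem with $\mathsf{MRad}=\Theta(\log n)$ and $\exists\mathsf{MVol}=\Theta(\log^k n)$, and for all integers $q>p>1$, with $\alpha=p/q$, there is an LCL problem with $\mathsf{MRad}=\Theta(\log n)$ and $\exists\mathsf{MVol}=\Theta(n^{\alpha})$.
   Context: All graphs have maximum degree bounded by a constant. An LCL problem $\Pi=(\Sigma,\mathcal G,\phi)$ consists of a finite label set $\Sigma$, a class $\mathcal G$ of input graphs, and a local verifier $\phi$ of constant radius $r$: $\phi(G,\lambda,v)\in\{\text{happy},\text{unhappy}\}$ depends only on the isomorphism type of the labeled radius-$r$ neighborhood of $v$. A partial solution is a labeling $\lambda:V(G)\to\Sigma\sqcup\{\bot\}$ such that every vertex with no $\bot$ within distance $r$ is happy. A hole is a vertex labeled $\bot$. A mend of $\lambda$ at a hole $v$ is a partial solution $\lambda'$ with $\lambda'(v)\neq\bot$ and $\lambda'(u)\neq\bot$ whenever $\lambda(u)\ne\bot$. Mends are assumed to always exist. On $n$-vertex instances (with $G\in\mathcal G$ ranging over $n$-vertex instances, $\lambda$ over partial solutions, $v$ over holes of $\lambda$, and $\lambda'$ over mends of $\lambda$ at $v$): $\exists\mathsf{MVol}=\max_{G,\lambda,v}\min_{\lambda'}|\{u:\lambda(u)\neq\lambda'(u)\}|$ is the existential mending volume, and $\mathsf{MRad}=\max_{G,\lambda,v}\min_{\lambda'}\max\{\mathrm{dist}(v,u):\lambda(u)\ne\lambda'(u)\}$ is the mending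 radius. Both are regarded as functions of $n$. *)

(* Defs.v *)
From HB Require Import structures.
From mathcomp Require Import all_boot all_order all_algebra.
From mathcomp Require Import all_classical all_reals all_analysis.

Set Implicit Arguments.
Unset Strict Implicit.
Unset Printing Implicit Defensive.

(** Finite simple graphs with vertex set ['I_n]. Every notion below is invariant
    under isomorphism, so these represent all [n]-vertex graphs; fixing the
    vertex set makes them a [finType], so that a maximum over all [n]-vertex
    graphs is a [\max]. *)
Record sgraph (n : nat) := SGraph {
  edges : {set 'I_n * 'I_n};
  edgesP : [forall u, forall v,
    ((u, v) \in edges) ==> (u != v) && ((v, u) \in edges)] }.

HB.instance Definition _ n := [isSub for @edges n].
HB.instance Definition _ n := [Finite of sgraph n by <:].

Section Graphs.
Variables (n : nat) (G : sgraph n).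

Definition adj : rel 'I_n := fun u v => (u, v) \in edges G.

Definition degree (v : 'I_n) : nat := #|[set u | adj v u]|.

Definition max_degree : nat := \max_(v < n) degree v.

Definition walk (d : nat) (u v : 'I_n) : bool :=
  [exists p : d.-tuple 'I_n, path adj u p && (last u p == v)].

(** Closed ball: the vertices at distance at most [r] from [v]. *)
Definition gball (r : nat) (v : 'I_n) : {set 'I_n} :=
  [set u | [exists d : 'I_r.+1, walk d v u]].

(** Distances within a component are less than [n]; the value [n] stands for
    infinity, i.e. for vertices in distinct components. *)
Definition dist (u v : 'I_n) : nat := \big[minn/n]_(d < n | walk d u v) d.

Definition gconnected : bool := [forall u, forall v, connect adj u v].

(** No simple cycle; a cycle has at least three vertices, and at most [n]. *)
Definition acyclic : bool :=
  [forall m : 'I_n.+1, forall c : m.-tuple 'I_n, (2 < m) ==> ~~ ucycleb adj c].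

Definition is_tree : bool := [&& 0 < n, gconnected & acyclic].

End Graphs.

Definition graph_iso n m (G : sgraph n) (H : sgraph m) : Prop :=
  exists f : 'I_n -> 'I_m,
    bijective f /\ forall x y, adj H (f x) (f y) = adj G x y.

Definition graph_class := forall n, pred (sgraph n).

Definition iso_closed (C : graph_class) : Prop :=
  forall n m (G : sgraph n) (H : sgraph m), graph_iso G H -> C n G = C m H.

Definition trees : graph_class := fun n G => is_tree G.
Definition all_graphs : graph_class := fun _ _ => true.

(** Labelings with values in [Sigma] extended by bottom, encoded as [None]. *)
Definition labeling (Sigma : finType) (n : nat) := {ffun 'I_n -> option Sigma}.

(** The radius-[r] neighborhoods of [v] in [(G, lam)] and of [w] in [(H, mu)],
    that is, the labeled subgraphs induced by the balls and rooted at their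
    centers, are isomorphic. *)
Definition gball_iso (Sigma : finType) (r : nat)
    n (G : sgraph n) (lam : labeling Sigma n) (v : 'I_n)
    m (H : sgraph m) (mu : labeling Sigma m) (w : 'I_m) : Prop :=
  exists f : 'I_n -> 'I_m,
    [/\ f v = w,
        {in gball G r v &, injective f} /\ f @: gball G r v = gball H r w,
        {in gball G r v &, forall x y, adj H (f x) (f y) = adj G x y} &
        {in gball G r v, forall x, mu (f x) = lam x}].

Record LCL := MkLCL {
  labels : finType;
  inputs : graph_class;
  inputs_iso : iso_closed inputs;
  degree_bound : nat;
  inputs_degree : forall n (G : sgraph n),
    inputs G -> max_degree G <= degree_bound;
  check_radius : nat;
  happy : forall n, sgraph n -> labeling labels n -> pred 'I_n;
  happy_local : forall n (G : sgraph n) (lam : labeling labels n) (v : 'I_n)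
                       m (H : sgraph m) (mu : labeling labels m) (w : 'I_m),
    gball_iso check_radius G lam v H mu w -> happy G lam v = happy H mu w }.

Section Mending.
Variable Pi : LCL.

Definition hole n (lam : labeling (labels Pi) n) (v : 'I_n) : bool :=
  lam v == None.

Definition partial_solution n (G : sgraph n)
    (lam : labeling (labels Pi) n) : bool :=
  [forall v,
    [forall u in gball G (check_radius Pi) v, ~~ hole lam u] ==> happy G lam v].

Definition mend n (G : sgraph n) (lam : labeling (labels Pi) n) (v : 'I_n)
    (lam' : labeling (labels Pi) n) : bool :=
  [&& partial_solution G lam', ~~ hole lam' v &
      [forall u, ~~ hole lam u ==> ~~ hole lam' u]].

Definition mendable : Prop :=
  forall n (G : sgraph n) (lam : labeling (labels Pi) n) (v : 'I_n),
    inputs Pi G -> partial_solution G lam -> hole lam v ->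
    exists lam', mend G lam v lam'.

Definition changed n (lam lam' : labeling (labels Pi) n) : {set 'I_n} :=
  [set u | lam u != lam' u].

Definition mend_volume n (lam lam' : labeling (labels Pi) n) : nat :=
  #|changed lam lam'|.

Definition mend_radius n (G : sgraph n) (v : 'I_n)
    (lam lam' : labeling (labels Pi) n) : nat :=
  \max_(u in changed lam lam') dist G v u.

(** The unit [n] of [\big[minn/n]] bounds the volume and the radius of every
    mend, so for mendable problems the minima below are those over all mends. The
    infinite value of [dist] never attains the minimum: undoing a mend outside
    the component of [v] leaves a mend. *)
Definition EMVol (n : nat) : nat :=
  \max_(G : sgraph n | inputs Pi G)
  \max_(lam : labeling (labels Pi) n | partial_solution G lam)
  \max_(v < n | hole lam v)
  \big[minn/n]_(lam' : labeling (labels Pi) n | mend G lam v lam')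
     mend_volume lam lam'.

Definition MRad (n : nat) : nat :=
  \max_(G : sgraph n | inputs Pi G)
  \max_(lam : labeling (labels Pi) n | partial_solution G lam)
  \max_(v < n | hole lam v)
  \big[minn/n]_(lam' : labeling (labels Pi) n | mend G lam v lam')
     mend_radius G v lam lam'.

(** The input graphs are exactly the members of [C] of bounded degree. *)
Definition inputs_from (C : graph_class) : Prop :=
  forall n (G : sgraph n),
    inputs Pi G = C n G && (max_degree G <= degree_bound Pi).

End Mending.

Section Theta.
Import GRing.Theory.
Local Open Scope ring_scope.
Local Open Scope classical_set_scope.

Definition is_Theta (R : realType) (f : nat -> nat) (g : nat -> R) : Prop :=
  (fun n => (f n)%:R : R^o) \is 'Theta_\oo (g : nat -> R^o).

End Theta.

(* Main.v *)
Require Import Defs.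
From mathcomp Require Import all_boot all_order zify.

Set Implicit Arguments.
Unset Strict Implicit.
Unset Printing Implicit Defensive.

(** A gate is a vertex whose degree encodes a type [j < K] and a phase modulo 3;
    the phases orient the edges between gates, so that a gate of type [j] has [m]
    children of type [j] and, if [j > 0], one child of type [j - 1]. A lit gate
    needs [t] lit children of its own type and its child of lower type lit, and a
    vertex without a parent must be lit. Lighting a hole thus forces a subtree of
    lit gates to grow downwards, in which the mender only chooses which [t] of the
    [m] children of each gate to light.

    Choosing the [t] lightest children divides the total weight by [m / t] at each
    level, so [m ^ L >= n] bounds the lit subtree of a type by about [t ^ L]; every
    vertex of it starts a subtree of the type below. Choosing the shallowest
    children instead at least halves the number of descendants at each level, as
    [t < m]: the radius is logarithmic. Complete trees of gates match both bounds.

    With [m = 2], [t = 1] and [K = k] the volume is [log ^ k n]; with [m = 2 ^ q],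
    [t = 2 ^ p] and [K = 1] it is [n ^ (p / q)]. *)

(** * Strategies in forests *)

(** Deleting a heaviest element does not raise the average weight, so the set is thinned out one
    element at a time. The averages are multiplied out to avoid division. *)
Lemma light_subset (V : finType) (w : V -> nat) (A : {set V}) (t : nat) :
  0 < t <= #|A| ->
  exists T : {set V}, [/\ T \subset A, #|T| = t &
    #|A| * \sum_(y in T) w y <= t * \sum_(y in A) w y].
Proof.
move=> /andP[t0]; move: {2}(#|A| - t) (erefl (#|A| - t)) => k.
elim: k A => [|k IH] A dk tA.
  by exists A; split=> //; [lia | have -> : #|A| = t by lia].
have [z0 z0A] : exists z, z \in A by apply/set0Pn; rewrite -card_gt0; lia.
have [z zA zmax] : exists2 z, z \in A & forall y, y \in A -> w y <= w z.
  by case: (arg_maxnP w z0A) => z zA zmax; exists z.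
have cA : #|A| = (#|A :\ z|).+1 by rewrite (cardsD1 z) zA.
have [||T [TA cT hT]] := IH (A :\ z); [lia | lia | ].
exists T; split=> //; first exact: subset_trans TA (subD1set _ _).
have sA : \sum_(y in A) w y = w z + \sum_(y in A :\ z) w y.
  by rewrite (big_setD1 z zA).
have sz : \sum_(y in A :\ z) w y <= #|A :\ z| * w z.
  rewrite -sum_nat_const; apply: leq_sum => y; rewrite in_setD1 => /andP[_].
  exact: zmax.
rewrite sA; move: hT sz; rewrite cA.
set a := #|A :\ z|; set s := \sum_(y in T) _; set s' := \sum_(y in _) _.
have a0 : 0 < a by rewrite /a; lia.
(* Scaling by [a] makes [hT], which bounds [a * s], applicable. *)
move=> hT sz; rewrite -(leq_pmul2l a0); nia.
Qed.

Lemma leq_card_bigcup (V I : finType) (T : {set I}) (F : I -> {set V}) :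
  #|\bigcup_(y in T) F y| <= \sum_(y in T) #|F y|.
Proof.
elim/big_rec2: _ => [|y s U _ h]; first by rewrite cards0.
by rewrite (leq_trans (leq_card_setU _ _)) // leq_add2l.
Qed.

Lemma leq_card_bigcup_const (V I : finType) (T : {set I}) (F : I -> {set V}) c :
  (forall y, y \in T -> #|F y| <= c) -> #|\bigcup_(y in T) F y| <= #|T| * c.
Proof.
move=> h; rewrite -sum_nat_const.
by apply: leq_trans (leq_card_bigcup _ _) _; apply: leq_sum.
Qed.

Section Strategies.
Variables (V : finType) (m t : nat) (ty : V -> nat) (act : pred V).
Variables (A B : V -> {set V}).
Hypotheses (t0 : 0 < t) (tm : t < m).
Hypothesis cardA : forall x, act x -> #|A x| = m.
Hypothesis cardB : forall x, act x -> #|B x| <= 1.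
Hypothesis tyA : forall x y, y \in A x -> ty y = ty x.
Hypothesis tyB : forall x y, y \in B x -> (ty y).+1 = ty x.

Definition edge : rel V := fun x y => act x && (y \in A x :|: B x).
Hypothesis edge_inj : forall x x' y, edge x y -> edge x' y -> x = x'.

(** A set that may be lit as a whole. Inactive members carry no obligation, so a strategy may end
    there. *)
Definition strategy (S : {set V}) :=
  forall x, x \in S -> act x -> t <= #|A x :&: S| /\ B x \subset S.

Definition desc (x : V) : {set V} := [set y | connect edge x y].
(* Parents are unique but [edge] may have cycles, where descendants of siblings
   overlap. Being off a cycle is inherited by children and rules this out. *)
Definition off_cycle (x : V) := forall y, edge x y -> ~~ connect edge y x.

(** A cycle through [y] would enter it from its only parent [x] and hence pass through [x]. *)
Lemma off_cycle_edge x y : off_cycle x -> edge x y -> off_cycle y.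
Proof.
move=> ox exy z eyz; apply/negP => czy.
case/connectP: czy => p; elim/last_ind: p => [_ /= yz|p u _].
  by subst z; have := ox y exy; rewrite (edge_inj exy eyz) connect0.
rewrite rcons_path last_rcons => /andP[pp eu] uy; subst u.
have xl := edge_inj exy eu.
have := ox y exy; rewrite xl; case/negP.
apply: connect_trans (connect1 eyz) _; apply/connectP; by exists p.
Qed.

(** Parents being unique, two paths ending in [z] agree when read backwards until one of them is
    exhausted. *)
Lemma connect_ancestors x y z :
  connect edge x z -> connect edge y z -> connect edge x y \/ connect edge y x.
Proof.
case/connectP => p; elim/last_ind: p z => [z _ /= ->|p u IH z]; first by right.
rewrite rcons_path last_rcons => /andP[pp eu] ->{z}.
case/connectP => q; case/lastP: q => [_ /= <-|q v].
  left; apply: connect_trans (connect1 eu); apply/connectP; by exists p.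
rewrite rcons_path last_rcons => /andP[pq ev] uv; subst v.
apply: (IH _ pp erefl); rewrite (edge_inj eu ev).
by apply/connectP; exists q.
Qed.

(** A common descendant would make one sibling reach the other; that path enters its end through the
    common parent [x], which closes a cycle at [x]. *)
Lemma desc_disjoint x y y' : off_cycle x -> edge x y -> edge x y' -> y != y' ->
  [disjoint desc y & desc y'].
Proof.
have key u u' : off_cycle x -> edge x u -> edge x u' -> u != u' ->
    ~ connect edge u u'.
  move=> ox eu eu' /eqP neq /connectP[p]; case/lastP: p => [_ /= /esym //|p v].
  rewrite rcons_path last_rcons => /andP[pp ev] vE; subst v.
  have := ox _ eu; rewrite (edge_inj eu' ev) => /negP; apply.
  by apply/connectP; exists p.
move=> ox ey ey' neq; apply/pred0P => z /=; apply/negbTE/negP.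
rewrite !inE => /andP[yz y'z].
case: (connect_ancestors yz y'z); first exact: key.
by apply: key => //; rewrite eq_sym.
Qed.

(** The sets of descendants are disjoint and all miss [x], whence the strict inequality. *)
Lemma sum_card_desc x (Y : {set V}) : off_cycle x -> (forall y, y \in Y -> edge x y) ->
  \sum_(y in Y) #|desc y| < #|desc x|.
Proof.
move=> ox eY.
have -> : \sum_(y in Y) #|desc y| = #|\bigcup_(y in Y) desc y|.
  elim: {Y}#|Y| {-2}Y (leqnn #|Y|) eY => [|k IH] Y cY eY.
    by move: cY; rewrite leqn0 cards_eq0 => /eqP->; rewrite !big_set0 cards0.
  have [->|[y yY]] := set_0Vmem Y; first by rewrite !big_set0 cards0.
  rewrite !(big_setD1 y yY) /= IH; last 2 first.
  - by move: cY; rewrite (cardsD1 y) yY.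
  - by move=> z; rewrite in_setD1 => /andP[_ /eY].
  rewrite cardsU; set I := _ :&: _; suff -> : I = set0 by rewrite cards0 subn0.
  apply/setP => z; rewrite [RHS]inE; apply/negbTE/negP; rewrite inE.
  case/andP => zy /bigcupP[y']; rewrite in_setD1 => /andP[ne y'Y] zy'.
  have := desc_disjoint ox (eY _ y'Y) (eY _ yY) ne.
  by move/pred0P/(_ z); rewrite /= zy zy'.
apply: proper_card; apply/properP; split.
  apply/bigcupsP => y yY; apply/subsetP => z; rewrite !inE.
  exact: connect_trans (connect1 (eY _ yY)).
exists x; first by rewrite inE connect0.
apply/negP => /bigcupP[y yY]; rewrite inE.
by apply/negP; apply: ox; apply: eY.
Qed.

Lemma strategyU (I : finType) (Y : {set I}) (F : I -> {set V}) :
  (forall y, y \in Y -> strategy (F y)) -> strategy (\bigcup_(y in Y) F y).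
Proof.
move=> h x /bigcupP[y yY xF] ax; have [h1 h2] := h y yY x xF ax.
have sF : F y \subset \bigcup_(y in Y) F y by exact: bigcup_sup.
split; last exact: subset_trans sF.
exact: leq_trans h1 (subset_leq_card (setIS _ sF)).
Qed.

Lemma strategy_cons x (T : {set V}) (F : V -> {set V}) :
  (act x -> [/\ t <= #|T|, T \subset A x & forall y, y \in T :|: B x -> y \in F y]) ->
  (forall y, y \in T :|: B x -> strategy (F y)) ->
  strategy (x |: \bigcup_(y in T :|: B x) F y).
Proof.
move=> hx hF z; rewrite in_setU1 => /orP[/eqP->|zS] az.
  have [cT TA FF] := hx az.
  have sub : T :|: B x \subset \bigcup_(y in T :|: B x) F y.
    by apply/subsetP => y yT; apply/bigcupP; exists y => //; apply: FF.
  split.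
    apply: leq_trans cT _; apply: subset_leq_card; rewrite subsetI TA /=.
    by apply: subset_trans (subsetUr _ _); apply: subset_trans sub; apply: subsetUl.
  by apply: subset_trans (subsetUr _ _); apply: subset_trans sub; apply: subsetUr.
have [h1 h2] := strategyU hF zS az; split.
  by apply: leq_trans h1 (subset_leq_card (setIS _ (subsetUr _ _))).
by apply: subset_trans h2 (subsetUr _ _).
Qed.

Lemma strategy1 x : ~~ act x -> strategy [set x].
Proof. by move=> ax z; rewrite inE => /eqP-> az; rewrite az in ax. Qed.

Lemma strategy_desc x : strategy (desc x).
Proof.
move=> z; rewrite inE => xz az.
have sub : A z :|: B z \subset desc x.
  apply/subsetP => y yz; rewrite inE (connect_trans xz) // connect1 //.
  by rewrite /edge az.
move: sub; rewrite subUset => /andP[sA sB]; split=> //.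
by rewrite (setIidPl sA) cardA // ltnW.
Qed.

Lemma disjointAB x : [disjoint A x & B x].
Proof.
apply/pred0P => y /=; apply/negbTE/negP => /andP[/tyA yA /tyB yB]; lia.
Qed.

(** Kept as a sum rather than a quotient, because [t = 1] is one of the two cases needed. *)
Definition geom (L : nat) := \sum_(l < L) t ^ l.

Lemma geomS L : geom L.+1 = 1 + t * geom L.
Proof.
rewrite /geom big_ord_recl expn0 big_distrr /=; congr addn.
by apply: eq_bigr => i _; rewrite /= /bump /= add1n expnS.
Qed.

(* For every [L] the size is bounded by an affine function of [#|desc x|]; taking
   affine bounds instead of the power of [#|desc x|] they envelop replaces a
   concavity argument by induction on [L]. [c] bounds strategies one type below. *)
Lemma small_strategy_step c L x :
  (forall y, off_cycle y -> (ty y).+1 = ty x ->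
     exists S : {set V}, [/\ y \in S, strategy S & #|S| <= c]) ->
  off_cycle x ->
  exists S : {set V}, [/\ x \in S, strategy S &
    #|S| * m ^ L <= c.+1 * geom L * m ^ L + #|desc x| * t ^ L].
Proof.
elim: L x => [|L IH] x hc ox.
  exists (desc x); split; [by rewrite inE connect0|exact: strategy_desc|].
  by rewrite !expn0 !muln1 leq_addl.
have [ax|nax] := boolP (act x); last first.
  exists [set x]; split; [by rewrite inE|exact: strategy1|].
  rewrite cards1 geomS; apply: leq_trans (leq_addr _ _).
  by apply: leq_mul => //; rewrite mulSn.
have eA y : y \in A x -> edge x y by move=> yA; rewrite /edge ax inE yA.
have eB y : y \in B x -> edge x y by move=> yB; rewrite /edge ax inE yB orbT.
(* Weighing children by their descendants keeps at most the fraction [t / m] of these, which pays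
   for raising [L] by one. *)
have [|T [TA cT sT]] := light_subset (fun y => #|desc y|) (A := A x) (t := t).
  by rewrite t0 cardA // ltnW.
have exF y : exists S : {set V},
   (y \in T -> [/\ y \in S, strategy S &
      #|S| * m ^ L <= c.+1 * geom L * m ^ L + #|desc y| * t ^ L]) /\
   (y \in B x -> [/\ y \in S, strategy S & #|S| <= c]).
  have [yT|nyT] := boolP (y \in T).
    have yA := subsetP TA _ yT.
    have [|S hS] := IH y _ (off_cycle_edge ox (eA _ yA)).
      by move=> z oz tz; apply: hc => //; rewrite tz (tyA yA).
    exists S; split=> // yB.
    by have := disjointAB x; move/pred0P/(_ y); rewrite /= yA yB.
  have [yB|nyB] := boolP (y \in B x); last by exists set0.
  have [S hS] := hc y (off_cycle_edge ox (eB _ yB)) (tyB yB).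
  by exists S.
have [F hF] := fin_all_exists exF.
exists (x |: \bigcup_(y in T :|: B x) F y); split; first by rewrite setU11.
  apply: strategy_cons.
    move=> _; split=> //; first by rewrite cT.
    by move=> y; rewrite inE => /orP[/(proj1 (hF y))|/(proj2 (hF y))] [].
  by move=> y; rewrite inE => /orP[/(proj1 (hF y))|/(proj2 (hF y))] [].
rewrite bigcup_setU.
have cBB : #|\bigcup_(y in B x) F y| <= c.
  apply: leq_trans (leq_card_bigcup_const (c := c) _) _.
    by move=> y /(proj2 (hF y))[].
  by rewrite -{2}[c]mul1n leq_mul2r (cardB ax) orbT.
have cTT : #|\bigcup_(y in T) F y| * m ^ L <=
    t * (c.+1 * geom L * m ^ L) + (\sum_(y in T) #|desc y|) * t ^ L.
  apply: leq_trans (_ : (\sum_(y in T) #|F y|) * m ^ L <= _).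
    by rewrite leq_mul2r leq_card_bigcup orbT.
  rewrite !big_distrl /= -{1}cT -sum_nat_const -big_split /=.
  by apply: leq_sum => y /(proj1 (hF y))[].
have sD : \sum_(y in A x) #|desc y| <= #|desc x| by apply/ltnW/sum_card_desc.
rewrite cardA // in sT.
have cS : #|x |: (\bigcup_(y in T) F y :|: \bigcup_(y in B x) F y)| <=
    1 + (#|\bigcup_(y in T) F y| + c).
  rewrite -(cards1 x); apply: leq_trans (leq_card_setU _ _) _.
  rewrite leq_add2l; apply: leq_trans (leq_card_setU _ _) _.
  by rewrite leq_add2l.
apply: leq_trans (_ : (1 + (#|\bigcup_(y in T) F y| + c)) * m ^ L.+1 <= _).
  by rewrite leq_mul2r cS orbT.
rewrite geomS !expnS.
move: cTT sT sD; set u := #|_|; set s := \sum_(y in T) _; set s' := \sum_(y in _) _.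
set d := #|desc x|; set g := geom L; set M := m ^ L; set N := t ^ L => cTT sT sD.
have h1 : u * (m * M) <= m * (t * (c.+1 * g * M)) + t * s' * N.
  apply: leq_trans (_ : m * (t * (c.+1 * g * M) + s * N) <= _).
    by rewrite mulnCA leq_mul2l cTT orbT.
  by rewrite mulnDr leq_add2l mulnA leq_mul2r sT orbT.
have h2 : t * s' * N <= d * (t * N).
  by rewrite -mulnA mulnCA leq_mul2r sD orbT.
have -> : (1 + (u + c)) * (m * M) = c.+1 * (m * M) + u * (m * M) by lia.
apply: leq_trans (leq_add (leqnn _) (leq_trans h1 (leq_add (leqnn _) h2))) _.
by rewrite addnA leq_add2r; apply: eq_leq; lia.
Qed.

(** The successor counts a vertex together with the strategy it starts one type below, [geom L]
    counts such vertices on [L] levels, and [t ^ L] is what [#|desc x| <= m ^ L] leaves of the last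
    term of [small_strategy_step]. *)
Fixpoint volume_bound (L j : nat) : nat :=
  (if j is i.+1 then volume_bound L i else 0).+1 * geom L + t ^ L.

Lemma small_strategy L j x : #|V| <= m ^ L -> ty x = j -> off_cycle x ->
  exists S : {set V}, [/\ x \in S, strategy S & #|S| <= volume_bound L j].
Proof.
move=> VL; elim: j x => [|j IH] x tx ox.
- have [|S [xS sS cS]] := @small_strategy_step 0 L x _ ox.
    by move=> y _; rewrite tx.
  exists S; split=> //=; rewrite -(@leq_pmul2r (m ^ L)) ?expn_gt0; last lia.
  apply: leq_trans cS _; rewrite mulnDl leq_add2l mulnC leq_mul2l.
  by rewrite (leq_trans (max_card _) VL) orbT.
- have [|S [xS sS cS]] := @small_strategy_step (volume_bound L j) L x _ ox.
    by move=> y oy; rewrite tx => -[ty_]; apply: IH.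
  exists S; split=> //=; rewrite -(@leq_pmul2r (m ^ L)) ?expn_gt0; last lia.
  apply: leq_trans cS _; rewrite mulnDl leq_add2l mulnC leq_mul2l.
  by rewrite (leq_trans (max_card _) VL) orbT.
Qed.

(** * Shallow strategies *)

Fixpoint near (r : nat) (x : V) : {set V} :=
  x |: (if r is s.+1 then \bigcup_(y | edge x y) near s y else set0).

Lemma near_self r x : x \in near r x.
Proof. by case: r => [|r]; rewrite /= setU11. Qed.

Lemma near_S r x : near r x \subset near r.+1 x.
Proof.
elim: r x => [|r IH] x; first by rewrite /= setU0 subsetUl.
rewrite [near r.+1 x]/= [near r.+2 x]/=; apply: setUS.
apply/bigcupsP => y exy; apply: subset_trans (IH y) _.
exact: (bigcup_sup y).
Qed.

Lemma near_le r s x : r <= s -> near r x \subset near s x.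
Proof.
move=> /subnK<-; elim: (s - r) => [|k IH]; first by rewrite add0n.
by rewrite addSn; apply: subset_trans IH (near_S _ _).
Qed.

Lemma near_edge r x y : edge x y -> near r y \subset near r.+1 x.
Proof. by move=> exy /=; apply: subset_trans (subsetUr _ _); apply: (bigcup_sup y). Qed.

(** Each step inside a type halves the bound on the descendants, so there are at most [r] of them; a
    child of lower type, wherever it branches off, adds depth [c]. *)
Lemma shallow_strategy_step c r x :
  (forall y, off_cycle y -> (ty y).+1 = ty x ->
     exists S : {set V}, [/\ y \in S, strategy S & S \subset near c y]) ->
  off_cycle x -> #|desc x| < 2 ^ r ->
  exists S : {set V}, [/\ x \in S, strategy S & S \subset near (r + c) x].
Proof.
elim: r x => [|r IH] x hc ox dx.
  have : 0 < #|desc x| by apply/card_gt0P; exists x; rewrite inE connect0.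
  by rewrite expn0 in dx; lia.
have [ax|nax] := boolP (act x); last first.
  exists [set x]; split; [by rewrite inE|exact: strategy1|].
  by rewrite sub1set near_self.
have eA y : y \in A x -> edge x y by move=> yA; rewrite /edge ax inE yA.
have eB y : y \in B x -> edge x y by move=> yB; rewrite /edge ax inE yB orbT.
(* At most one child has [2 ^ r] descendants, and [t < m]. *)
pose T := [set y in A x | #|desc y| < 2 ^ r].
have TA : T \subset A x by apply/subsetP => y; rewrite inE => /andP[].
have cT : t <= #|T|.
  have : #|A x :\: T| * 2 ^ r <= \sum_(y in A x :\: T) #|desc y|.
    rewrite -sum_nat_const; apply: leq_sum => y.
    by rewrite in_setD [y \in T]inE => /andP[+ yA]; rewrite yA -leqNgt.
  have : \sum_(y in A x :\: T) #|desc y| < #|desc x|.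
    by apply: sum_card_desc => // y; rewrite inE => /andP[_ /eA].
  have := cardsD (A x) T; rewrite (setIidPr TA) (cardA ax) => -> h1 h2.
  have : (m - #|T|) * 2 ^ r < 2 * 2 ^ r by rewrite -expnS; lia.
  by rewrite ltn_pmul2r ?expn_gt0 //; lia.
have exF y : exists S : {set V}, y \in T :|: B x ->
    [/\ y \in S, strategy S & S \subset near (r + c) y].
  have [|nyT] := boolP (y \in T).
    rewrite inE => /andP[yA dy].
    have [|S hS] := IH y _ (off_cycle_edge ox (eA _ yA)) dy.
      by move=> z oz tz; apply: hc => //; rewrite tz (tyA yA).
    by exists S.
  have [yB|nyB] := boolP (y \in B x).
    have [S [yS sS nS]] := hc y (off_cycle_edge ox (eB _ yB)) (tyB yB).
    exists S; split=> //; apply: subset_trans nS (near_le _ _); exact: leq_addl.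
  by exists set0; rewrite inE (negbTE nyT) (negbTE nyB).
have [F hF] := fin_all_exists exF.
exists (x |: \bigcup_(y in T :|: B x) F y); split; first by rewrite setU11.
  apply: strategy_cons; last by move=> y /hF[].
  by move=> _; split=> // y /hF[].
rewrite subUset sub1set near_self; apply/bigcupsP => y yTB.
have [_ _ h] := hF y yTB; apply: subset_trans h _; rewrite addSn.
apply: near_edge; move: yTB; rewrite inE => /orP[/(subsetP TA)/eA //|/eB //].
Qed.

Lemma shallow_strategy r j x : #|V| < 2 ^ r -> ty x = j -> off_cycle x ->
  exists S : {set V}, [/\ x \in S, strategy S & S \subset near (j.+1 * r) x].
Proof.
move=> Vr; have dV y : #|desc y| < 2 ^ r by apply: leq_ltn_trans (max_card _) Vr.
elim: j x => [|j IH] x tx ox.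
  have [|//|//|S hS] := @shallow_strategy_step 0 r x.
    by move=> y _; rewrite tx.
  by exists S; rewrite mul1n -[r in near r]addn0.
have [|//|//|S hS] := @shallow_strategy_step (j.+1 * r) r x.
  by move=> y oy; rewrite tx => -[ty_]; apply: IH.
by exists S; rewrite mulSn.
Qed.

End Strategies.

(** * The gate problem *)

Lemma bigminn_le (I : finType) (P : pred I) (F : I -> nat) N i :
  P i -> \big[minn/N]_(j | P j) F j <= F i.
Proof.
move=> Pi; have := mem_index_enum i; elim: (index_enum I) => // j s IH.
rewrite inE big_cons => /orP[/eqP<-|/IH le_s]; first by rewrite Pi geq_minl.
by case: ifP => // _; rewrite geq_min le_s orbT.
Qed.

Lemma bigminn_ge (I : finType) (P : pred I) (F : I -> nat) N c :
  c <= N -> (forall i, P i -> c <= F i) -> c <= \big[minn/N]_(j | P j) F j.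
Proof.
move=> cN cF; elim/big_ind: _ => // x y cx cy.
by rewrite leq_min cx cy.
Qed.

(** * Walks, balls and distances in finite graphs *)

Section GraphFacts.
Variables (n : nat) (G : sgraph n).

Lemma adj_sym : symmetric (adj G).
Proof.
move=> u v; rewrite /adj; have /forallP h := edgesP G.
apply/idP/idP => uv.
  by have /forallP/(_ v)/implyP/(_ uv)/andP[] := h u.
by have /forallP/(_ u)/implyP/(_ uv)/andP[] := h v.
Qed.

Lemma walkP d u v :
  reflect (exists p, [/\ size p = d, path (adj G) u p & last u p = v]) (walk G d u v).
Proof.
apply: (iffP existsP) => [[p /andP[pp /eqP lp]]|[p [sp pp lp]]].
  by exists p; rewrite size_tuple.
have sp' : size p == d by rewrite sp.
by exists (Tuple sp'); rewrite pp lp eqxx.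
Qed.

Lemma gballP r v u : reflect (exists2 d, d <= r & walk G d v u) (u \in gball G r v).
Proof.
rewrite inE; apply: (iffP existsP) => [[d w]|[d dr w]].
  by exists d => //; rewrite -ltnS.
by exists (Ordinal (dr : d < r.+1)).
Qed.

Lemma gball_id r v : v \in gball G r v.
Proof. by apply/gballP; exists 0 => //; apply/walkP; exists [::]. Qed.

Lemma gball_le r s v : r <= s -> gball G r v \subset gball G s v.
Proof.
move=> rs; apply/subsetP => u /gballP[d dr w]; apply/gballP; exists d => //.
exact: leq_trans rs.
Qed.

Lemma gball_adj r v u w : u \in gball G r v -> adj G u w -> w \in gball G r.+1 v.
Proof.
case/gballP => d dr /walkP[p [sp pp lp]] uw; apply/gballP; exists d.+1 => //.
apply/walkP; exists (rcons p w).
by rewrite size_rcons sp rcons_path pp lp uw last_rcons.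
Qed.

Lemma adj_gball r v u w : adj G v u -> w \in gball G r u -> w \in gball G r.+1 v.
Proof.
move=> vu /gballP[d dr /walkP[p [sp pp lp]]]; apply/gballP; exists d.+1 => //.
by apply/walkP; exists (u :: p); rewrite /= sp vu pp lp.
Qed.

Lemma gball0P v u : u \in gball G 0 v -> u = v.
Proof. by case/gballP => -[] // _ /walkP[p [/size0nil-> _ /= ->]]. Qed.

Lemma gballSP r v u : u \in gball G r.+1 v ->
  u \in gball G r v \/ exists2 y, y \in gball G r v & adj G y u.
Proof.
case/gballP => d; rewrite leq_eqVlt => /orP[/eqP->|dr w]; last first.
  by left; apply/gballP; exists d.
case/walkP => p; case/lastP: p => [[] //|p y [] /=].
rewrite size_rcons rcons_path last_rcons => -[sp] /andP[pp yu] <-; right.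
exists (last v p) => //; apply/gballP; exists r => //.
by apply/walkP; exists p.
Qed.

Lemma gball_sym r v u : u \in gball G r v -> v \in gball G r u.
Proof.
elim: r u => [|r IH] u; first by move/gball0P ->; apply: gball_id.
case/gballSP => [/IH|[y yv yu]]; first by apply/subsetP/gball_le.
by apply: adj_gball (IH _ yv); rewrite adj_sym.
Qed.

Lemma gball_trans r s v u w :
  u \in gball G r v -> w \in gball G s u -> w \in gball G (r + s) v.
Proof.
elim: s w => [|s IH] w uv; first by move/gball0P ->; rewrite addn0.
rewrite addnS; case/gballSP => [/(IH _ uv)|[y yu yw]].
  by apply/subsetP/gball_le.
exact: gball_adj (IH _ uv yu) yw.
Qed.

Lemma degree_le v : degree G v <= max_degree G.
Proof. exact: (leq_bigmax v). Qed.

Lemma card_gball r v : #|gball G r v| <= (max_degree G).+1 ^ r.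
Proof.
elim: r => [|r IH].
  rewrite expn0 -(cards1 v); apply: subset_leq_card.
  by apply/subsetP => u /gball0P->; rewrite inE.
have sub : gball G r.+1 v \subset
    gball G r v :|: \bigcup_(y in gball G r v) [set u | adj G y u].
  apply/subsetP => u /gballSP[h|[y yv yu]]; first by rewrite inE h.
  by rewrite inE; apply/orP; right; apply/bigcupP; exists y => //; rewrite inE.
apply: leq_trans (subset_leq_card sub) _.
apply: leq_trans (leq_card_setU _ _) _.
apply: leq_trans (_ : #|gball G r v| + #|gball G r v| * max_degree G <= _).
  rewrite leq_add2l; apply: leq_card_bigcup_const => y _; exact: degree_le.
by rewrite -mulnS expnSr leq_mul2r IH orbT.
Qed.

Lemma dist_le r v u : u \in gball G r v -> dist G v u <= r.
Proof.
have le_n : dist G v u <= n.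
  by rewrite /dist; elim/big_ind: _ => // [x y hx _|i _];
    [rewrite geq_min hx | exact: ltnW].
(* Walks of length [n] or more do not enter the minimum, but its default value [n] is then at most
   [r]. *)
case/gballP => d dr w; have [dn|nd] := ltnP d n; last first.
  by apply: leq_trans le_n (leq_trans nd dr).
apply: leq_trans dr; exact: (@bigminn_le _ _ (fun d : 'I_n => val d) n (Ordinal dn)).
Qed.

End GraphFacts.

(** * Invariance of degrees and of trees under isomorphism *)

Section Isomorphism.

Lemma graph_iso_sym n m (G : sgraph n) (H : sgraph m) : graph_iso G H -> graph_iso H G.
Proof.
case=> f [[g fK gK] fadj]; exists g; split; first by exists f.
by move=> x y; rewrite -fadj !gK.
Qed.

Lemma graph_iso_size n m (G : sgraph n) (H : sgraph m) : graph_iso G H -> n = m.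
Proof. by case=> f [/bij_eq_card]; rewrite !card_ord. Qed.

Lemma graph_iso_degree n m (G : sgraph n) (H : sgraph m) :
  graph_iso G H -> max_degree G <= max_degree H.
Proof.
case=> f [[g fK gK] fadj]; apply/bigmax_leqP => v _.
suff -> : degree G v = degree H (f v) by exact: degree_le.
rewrite /degree -(card_imset _ (can_inj fK)); apply: eq_card => z.
rewrite inE; apply/imsetP/idP => [[x]|].
  by rewrite inE => vx ->; rewrite fadj.
by move=> h; exists (g z); rewrite ?gK // inE -fadj gK.
Qed.

Lemma graph_iso_tree n m (G : sgraph n) (H : sgraph m) :
  graph_iso G H -> is_tree G -> is_tree H.
Proof.
(* The sizes are identified first, since [acyclic] bounds the length of cycles by the number of
   vertices. *)
move=> GH; have nm := graph_iso_size GH; case: m / nm H GH => H.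
case=> f [[g fK gK] fadj] /and3P[n0 cG aG]; apply/and3P; split=> //.
  apply/forallP => u; apply/forallP => v.
  have /forallP/(_ (g u))/forallP/(_ (g v))/connectP[p pp lp] := cG.
  apply/connectP; exists (map f p); last by rewrite -(gK u) last_map -lp gK.
  by rewrite -(gK u) path_map (eq_path (e' := adj G)).
apply/forallP => k; apply/forallP => c; apply/implyP => k2.
have /forallP/(_ k)/forallP/(_ (map_tuple g c))/implyP/(_ k2) := aG.
apply: contra => /andP[cc uc]; apply/andP; split; last first.
  by rewrite map_inj_uniq //; apply: can_inj gK.
move: cc => /=; case: (tval c) => //= x s; rewrite -map_rcons path_map.
by apply: sub_path => a b; rewrite /= -fadj !gK.
Qed.

Lemma trees_iso_closed : iso_closed trees.
Proof.
move=> n m G H GH; apply/idP/idP; first exact: graph_iso_tree.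
exact: graph_iso_tree (graph_iso_sym GH).
Qed.

End Isomorphism.

(** * The local rules for gates *)

Section GateRules.
Variables (K m t : nat).

(* [m.+2] is the least degree of a gate: a parent, [m] children of its type, and
   one more child that is either of lower type or a leaf. *)
Definition gate_degree (d : nat) : bool := m.+2 <= d < m.+2 + 3 * K.
Definition gate_type (d : nat) : nat := (d - m.+2) %/ 3.
Definition gate_phase (d : nat) : nat := (d - m.+2) %% 3.

(** The degree of the parent comes first. Phases modulo 3 rule out that two degrees feed each other,
    so an edge is oriented in at most one way. *)
Definition feeds (d d' : nat) : bool :=
  [&& gate_degree d, gate_degree d', gate_phase d' == (gate_phase d).+1 %% 3 &
      (gate_type d' == gate_type d) || ((gate_type d').+1 == gate_type d)].

Definition parents n (G : sgraph n) (y : 'I_n) : {set 'I_n} :=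
  [set x | adj G y x && feeds (degree G x) (degree G y)].

(** Insisting on a single parent makes the child relation injective in every input graph, tree or
    not. The index [i] is the drop in type. *)
Definition kids n (G : sgraph n) (i : nat) (x : 'I_n) : {set 'I_n} :=
  [set y | (parents G y == [set x]) &&
           (gate_type (degree G y) + i == gate_type (degree G x))].

(* Vertices whose children have the wrong numbers are not gates and carry no
   constraint: this is where the lit subtrees end. *)
Definition gate n (G : sgraph n) (x : 'I_n) : bool :=
  (#|kids G 0 x| == m) && (#|kids G 1 x| <= 1).

Definition gate_happy n (G : sgraph n) (lam : labeling bool n) (x : 'I_n) : bool :=
  if lam x == Some true then
    gate G x ==>
      (t <= #|[set y in kids G 0 x | lam y == Some true]|) &&
      [forall y in kids G 1 x, lam y == Some true]
  else parents G x != set0.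

Lemma kids_adj n (G : sgraph n) i x y : y \in kids G i x -> adj G x y.
Proof.
rewrite inE => /andP[/eqP/setP/(_ x)]; rewrite !inE eqxx => /andP[+ _] _.
by rewrite adj_sym.
Qed.

Section Local.
Variables (n n' : nat) (G : sgraph n) (H : sgraph n') (v : 'I_n) (f : 'I_n -> 'I_n').
Hypothesis f_inj : {in gball G 3 v &, injective f}.
Hypothesis f_im : f @: gball G 3 v = gball H 3 (f v).
Hypothesis f_adj : {in gball G 3 v &, forall x y, adj H (f x) (f y) = adj G x y}.

Lemma local_gball r x : r <= 3 -> x \in gball G r v -> f x \in gball H r (f v).
Proof.
elim: r x => [|r IH] x r3; first by move/gball0P->; apply: gball_id.
case/gballSP => [/(IH _ (ltnW r3))|[y yv yx]]; first exact/subsetP/gball_le.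
apply: gball_adj (IH _ (ltnW r3) yv) _; rewrite f_adj //.
  by apply: subsetP yv; apply/gball_le/ltnW.
by apply: subsetP (gball_adj yv yx); apply/gball_le.
Qed.

Lemma local_set (P : {set 'I_n}) (Q : {set 'I_n'}) :
  P \subset gball G 3 v -> Q \subset gball H 3 (f v) ->
  {in gball G 3 v, forall x, (f x \in Q) = (x \in P)} -> Q = f @: P.
Proof.
move=> PG QH PQ; apply/setP => z; apply/idP/imsetP => [zQ|[x xP ->]].
  have := subsetP QH _ zQ; rewrite -f_im => /imsetP[x xv zx].
  by exists x => //; rewrite -PQ // -zx.
by rewrite PQ // (subsetP PG).
Qed.

Lemma local_card (P : {set 'I_n}) : P \subset gball G 3 v -> #|f @: P| = #|P|.
Proof. by move=> PG; apply: card_in_imset => x y /(subsetP PG) hx /(subsetP PG); exact: f_inj. Qed.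

Lemma local_sub r s (P : {set 'I_n}) x : r.+1 <= s -> x \in gball G r v ->
  (forall y, y \in P -> adj G x y) -> P \subset gball G s v.
Proof.
move=> rs xv xP; apply/subsetP => y /xP xy.
by apply: subsetP (gball_adj xv xy); apply: gball_le.
Qed.

Lemma local_degree x : x \in gball G 2 v -> degree H (f x) = degree G x.
Proof.
move=> xv; have sP : [set w | adj G x w] \subset gball G 3 v.
  by apply: local_sub xv _ => // y; rewrite inE.
rewrite /degree (@local_set [set w | adj G x w] [set w | adj H (f x) w])
  ?local_card //.
  apply/subsetP => z; rewrite inE; apply: gball_adj.
  exact: local_gball xv.
move=> y yv; rewrite !inE f_adj //.
by apply: subsetP xv; apply: gball_le.
Qed.

Lemma local_parents y : y \in gball G 1 v -> parents H (f y) = f @: parents G y.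
Proof.
move=> yv; apply: local_set.
- by apply: local_sub yv _ => // w; rewrite inE => /andP[].
- apply/subsetP => z; rewrite inE => /andP[yz _].
  have h := gball_adj (local_gball (isT : 1 <= 3) yv) yz.
  by apply: subsetP h; apply: gball_le.
move=> x xv; rewrite !inE f_adj //; last by apply: subsetP yv; apply: gball_le.
case yx: (adj G y x) => //=; rewrite !local_degree //.
  by apply: subsetP yv; apply: gball_le.
exact: gball_adj yv yx.
Qed.

Lemma local_kids i : kids H i (f v) = f @: kids G i v.
Proof.
apply: local_set.
- apply: (@local_sub 0 3 _ v) => //; first exact: gball_id.
  by move=> y /kids_adj.
- apply/subsetP => z /kids_adj h.
  have := gball_adj (gball_id H 0 (f v)) h; apply/subsetP; exact: gball_le.
move=> y yv; have v3 := gball_id G 3 v.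
have [vy|nvy] := boolP (adj G v y); last first.
  apply/idP/idP => /kids_adj; last by rewrite (negbTE nvy).
  by rewrite f_adj // (negbTE nvy).
have y1 : y \in gball G 1 v by apply: gball_adj vy; apply: gball_id.
have sP : parents G y \subset gball G 3 v.
  by apply: local_sub y1 _ => // w; rewrite inE => /andP[].
rewrite !inE local_parents // !local_degree ?gball_id //; last first.
  by apply: subsetP y1; apply: gball_le.
congr andb; apply/idP/idP => /eqP; last by move=> ->; rewrite imset_set1.
(* Being the only parent transfers back because [f] is injective on the ball, which contains all
   candidates. *)
move=> E; apply/eqP.
apply/setP => z; rewrite in_set1; apply/idP/eqP => [zP|->].
  apply: f_inj => //; first exact: (subsetP sP).
  by apply/set1P; rewrite -E imset_f.
have /imsetP[u uP vu] : f v \in f @: parents G y by rewrite E inE.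
by rewrite (f_inj _ _ vu) // (subsetP sP).
Qed.

End Local.

(** Radius 3 is what the rule sees: children of [v] are at distance 1, the competing parents of
    these at distance 2, and the degrees of the latter count vertices at distance 3. *)
Lemma gate_local n (G : sgraph n) (lam : labeling bool n) (v : 'I_n)
    n' (H : sgraph n') (mu : labeling bool n') (w : 'I_n') :
  gball_iso 3 G lam v H mu w -> gate_happy G lam v = gate_happy H mu w.
Proof.
case=> f [<-{w} [f_inj f_im] f_adj f_lab].
have kE i := local_kids f_inj f_im f_adj i.
have kv i : kids G i v \subset gball G 3 v.
  apply: (@local_sub _ G v 0 3 _ v) => //; first exact: gball_id.
  by move=> y /kids_adj.
have kc (P : {set 'I_n}) : P \subset gball G 3 v -> #|f @: P| = #|P|.
  exact: local_card.
rewrite /gate_happy f_lab ?gball_id //; case: ifP => _; last first.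
  rewrite (local_parents f_inj f_im f_adj) ?gball_id //.
  by rewrite -!card_gt0 kc //; apply: (@local_sub _ G v 0 3 _ v) => //;
    [exact: gball_id | move=> y; rewrite inE => /andP[]].
rewrite /gate !kE !kc //; congr implb; congr andb.
  have -> : [set y in f @: kids G 0 v | mu y == Some true] =
      f @: [set y in kids G 0 v | lam y == Some true].
    apply/setP => z; rewrite inE; apply/andP/imsetP.
      case=> /imsetP[y yk ->] my; exists y => //; rewrite inE yk -f_lab //.
      exact: (subsetP (kv 0)).
    case=> y; rewrite inE => /andP[yk ly] ->; rewrite imset_f // f_lab //.
    exact: (subsetP (kv 0)).
  rewrite kc //; apply: subset_trans (kv 0).
  by apply/subsetP => y; rewrite inE => /andP[].
apply/forall_inP/forall_inP => [h z /imsetP[y yk ->]|h y yk].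
  by rewrite f_lab ?h // (subsetP (kv 1)).
by rewrite -f_lab ?h ?imset_f // (subsetP (kv 1)).
Qed.

Section Problem.
Variables (C : graph_class) (C_iso : iso_closed C).

(** The bound is the largest degree that encodes a gate. *)
Definition gate_inputs : graph_class :=
  fun n G => C G && (max_degree G <= m.+1 + 3 * K).

Lemma gate_inputs_iso : iso_closed gate_inputs.
Proof.
move=> n n' G H GH; rewrite /gate_inputs (C_iso GH); congr andb.
suff -> : max_degree G = max_degree H by [].
by apply/eqP; rewrite eqn_leq !graph_iso_degree //; apply: graph_iso_sym.
Qed.

Lemma gate_inputs_degree n (G : sgraph n) :
  gate_inputs G -> max_degree G <= m.+1 + 3 * K.
Proof. by case/andP. Qed.

Definition gate_problem : LCL :=
  MkLCL gate_inputs_iso gate_inputs_degree gate_local.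

End Problem.
End GateRules.

(** * Upper bounds for the gate problem *)

Lemma leq_volume_bound t L j j' : j <= j' -> volume_bound t L j <= volume_bound t L j'.
Proof.
have step i : volume_bound t L i <= volume_bound t L i.+1.
  elim: i => [|i IH]; first by rewrite /= leq_add2r leq_mul2r orbT.
  by rewrite [X in X <= _]/= [X in _ <= X]/= leq_add2r leq_mul2r ltnS IH orbT.
move=> /subnK<-; elim: (j' - j) => // i IH.
by rewrite addSn; apply: leq_trans IH (step _).
Qed.

Section GateUpper.
Variables (K m t : nat).
Hypotheses (t0 : 0 < t) (tm : t < m) (K0 : 0 < K).
Variables (C : graph_class) (C_iso : iso_closed C).
Local Notation Pi := (gate_problem K m t C_iso).
Local Notation D := (m.+1 + 3 * K).

Section Mend.
Variables (n : nat) (G : sgraph n) (lam : labeling bool n) (v : 'I_n).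
Hypotheses (GI : inputs Pi G) (lamP : @partial_solution Pi n G lam).

Let U := gball G 3 v.
Let gtype (x : 'I_n) := gate_type m (degree G x).
Let kid (x : 'I_n) := kids K m G 0 x :|: kids K m G 1 x.

(* Other holes of [lam] are left open, so that only vertices of [U] are newly
   checked. *)
Definition raise (S : {set 'I_n}) : labeling bool n :=
  [ffun u => if (u \in S) && ((u == v) || ~~ @hole Pi n lam u) then Some true else lam u].

Definition gate_closed (S : {set 'I_n}) := forall x, x \in S -> gate K m G x ->
  t <= #|kids K m G 0 x :&: S| /\ kids K m G 1 x \subset S.

Lemma raise_changed S : @changed Pi n lam (raise S) \subset S.
Proof.
by apply/subsetP => u; rewrite inE ffunE; case: (u \in S) => //; rewrite eqxx.
Qed.

(** A checked vertex of [S] sees no hole, so its children in [S] are all lit. A checked vertex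
    outside [S] lies outside [U] and does not see [v]; it was checked before, and lighting more
    vertices around it does no harm. *)
Lemma raise_mend S : gate_closed S -> U \subset S -> @mend Pi n G lam v (raise S).
Proof.
move=> cS US; have vS : v \in S by rewrite (subsetP US) // gball_id.
apply/and3P; split; last first.
- apply/forallP => u; apply/implyP => hu; rewrite /hole ffunE.
  by case: ifP.
- by rewrite /hole ffunE vS eqxx.
apply/forallP => w; apply/implyP => /forall_inP hw /=.
have one u : u \in gball G 3 w -> u \in S -> raise S u = Some true.
  move=> uw uS; have := hw u uw; rewrite /hole ffunE uS /=.
  by rewrite /hole; case: (lam u) => [a|] //=; rewrite ?orbT //; case: (u == v).
have kw i u : u \in kids K m G i w -> u \in gball G 3 w.
  move=> /kids_adj wu; apply: subsetP (gball_adj (gball_id G 0 w) wu).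
  exact: gball_le.
rewrite /gate_happy; have [wS|nwS] := boolP (w \in S).
  rewrite one ?gball_id // eqxx; apply/implyP => /(cS _ wS)[h1 h2].
  apply/andP; split; last first.
    by apply/forall_inP => u uk; rewrite one ?(kw 1) // (subsetP h2).
  apply: leq_trans h1 (subset_leq_card _); apply/subsetP => u.
  by rewrite in_setI in_set => /andP[uk uS]; rewrite uk one ?(kw 0).
have vw : v \notin gball G 3 w.
  apply: contra nwS => vw; apply: (subsetP US); exact: gball_sym.
have nh u : u \in gball G 3 w -> ~~ @hole Pi n lam u.
  move=> uw; have := hw u uw; apply: contra => hu; rewrite /hole ffunE.
  case: (u =P v) => [uv|_] /=; first by rewrite -uv uw in vw.
  by rewrite hu andbF.
have keep u : lam u = Some true -> raise S u = Some true.
  by move=> lu; rewrite ffunE; case: ifP.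
have -> : raise S w = lam w by rewrite ffunE (negbTE nwS).
have /forallP/(_ w)/implyP := lamP.
have hb : [forall u in gball G (check_radius Pi) w, ~~ @hole Pi n lam u].
  by apply/forall_inP => u /nh.
move=> /(_ hb) /=; rewrite /gate_happy; case: ifP => // _ /implyP h.
apply/implyP => /h /andP[h1 /forall_inP h2]; apply/andP; split.
  apply: leq_trans h1 (subset_leq_card _); apply/subsetP => u.
  by rewrite !in_set => /andP[-> /eqP/keep->].
by apply/forall_inP => u /h2/eqP/keep->.
Qed.

(* Cutting the edges below [U] leaves no cycle through the children [Y] of [U],
   whose only parents lie in [U]. *)
Let act (x : 'I_n) := gate K m G x && (x \notin U).
Let reach := edge act (kids K m G 0) (kids K m G 1).

Lemma kids_inj i i' x x' y : y \in kids K m G i x -> y \in kids K m G i' x' -> x = x'.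
Proof. by rewrite !inE => /andP[/eqP-> _] /andP[/eqP/set1_inj]. Qed.

Lemma reach_inj x x' y : reach x y -> reach x' y -> x = x'.
Proof.
by case/andP=> _ /setUP[] h /andP[_ /setUP[]] h'; apply: kids_inj h h'.
Qed.

Lemma reach_cardA x : act x -> #|kids K m G 0 x| = m.
Proof. by case/andP => /andP[/eqP]. Qed.

Lemma reach_cardB x : act x -> #|kids K m G 1 x| <= 1.
Proof. by case/andP => /andP[]. Qed.

Lemma reach_tyA x y : y \in kids K m G 0 x -> gtype y = gtype x.
Proof. by rewrite inE addn0 => /andP[_ /eqP]. Qed.

Lemma reach_tyB x y : y \in kids K m G 1 x -> (gtype y).+1 = gtype x.
Proof. by rewrite inE addn1 => /andP[_ /eqP]. Qed.

Let Y := \bigcup_(x in U) kid x.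

Lemma kid_off_cycle y : y \in Y -> off_cycle act (kids K m G 0) (kids K m G 1) y.
Proof.
case/bigcupP => x xU yx z yz; apply/negP => /connectP[p].
have key x' : reach x' y -> False.
  case/andP => /andP[_ nU] /setUP yx'; suff xx' : x = x' by rewrite -xx' xU in nU.
  by case/setUP: yx => h; case: yx' => h'; apply: kids_inj h h'.
case/lastP: p => [_ /= zy|p u]; first by apply: (key y); rewrite {2}zy.
by rewrite rcons_path last_rcons => /andP[_ eu] uy; apply: (key (last z p)); rewrite uy.
Qed.

(** Degrees that encode no gate are included: truncated subtraction gives small ones type 0, and the
    degree bound excludes large ones. *)
Lemma gtype_lt x : gtype x < K.
Proof.
have := leq_trans (degree_le G x) (gate_inputs_degree GI).
rewrite /gtype /gate_type; lia.
Qed.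

(** Gates in [U] get all their children, at least as many as they need; outside [U] every gate is
    active, so the strategies take over. *)
Lemma gate_closedU (F : 'I_n -> {set 'I_n}) :
  (forall y, y \in Y -> y \in F y /\ strategy t act (kids K m G 0) (kids K m G 1) (F y)) ->
  gate_closed (U :|: \bigcup_(y in Y) F y).
Proof.
move=> hF x xS gx; set S := _ :|: _.
have [xU|xU] := boolP (x \in U).
  have sub i : i < 2 -> kids K m G i x \subset S.
    move=> i2; apply/subsetP => y yx.
    have yY : y \in Y.
      apply/bigcupP; exists x => //; rewrite inE.
      by case: i i2 yx => [|[|i]] // _ ->; rewrite ?orbT.
    rewrite inE; apply/orP; right; apply/bigcupP; exists y => //.
    by case: (hF y yY).
  split; last exact: sub.
  by rewrite (setIidPl (sub 0 isT)); case/andP: gx => /eqP -> _; apply: ltnW.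
have sY : strategy t act (kids K m G 0) (kids K m G 1) (\bigcup_(y in Y) F y).
  by apply: strategyU => y /hF[].
have [||h1 h2] := sY x; last 1 first.
- split; last exact: subset_trans h2 (subsetUr _ _).
  exact: leq_trans h1 (subset_leq_card (setIS _ (subsetUr _ _))).
- by move: xS; rewrite inE (negbTE xU).
- by rewrite /act gx.
Qed.

Lemma card_reach : #|Y| <= #|U| * D.
Proof.
apply: leq_card_bigcup_const => x _.
apply: leq_trans (leq_trans (degree_le G x) (gate_inputs_degree GI)).
by apply: subset_leq_card; apply/subsetP => y /setUP[] /kids_adj; rewrite inE.
Qed.

(** The ball [U] has at most [D.+1 ^ 3] vertices, and each contributes itself and the strategies of
    at most [D] children. *)
Lemma small_mend L : n <= m ^ L ->
  exists2 lam', @mend Pi n G lam v lam' &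
    @mend_volume Pi n lam lam' <= D.+1 ^ 3 * (D * volume_bound t L K.-1).+1.
Proof.
move=> nL; have exF y : exists S : {set 'I_n}, y \in Y ->
    [/\ y \in S, strategy t act (kids K m G 0) (kids K m G 1) S &
        #|S| <= volume_bound t L K.-1].
  have [yY|nY] := boolP (y \in Y); last by exists set0.
  have [|S [yS sS cS]] := small_strategy t0 tm reach_cardA reach_cardB
    reach_tyA reach_tyB reach_inj (L := L) _ (erefl (gtype y)) (kid_off_cycle yY).
    by rewrite card_ord.
  exists S => _; split=> //; apply: leq_trans cS (leq_volume_bound _ _ _).
  by have := gtype_lt y; case: K K0.
have [F hF] := fin_all_exists exF.
exists (raise (U :|: \bigcup_(y in Y) F y)).
  apply: raise_mend; last exact: subsetUl.
  by apply: gate_closedU => y /hF[].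
apply: leq_trans (subset_leq_card (raise_changed _)) _.
apply: leq_trans (leq_card_setU _ _) _.
have cU : #|U| <= D.+1 ^ 3.
  apply: leq_trans (card_gball G 3 v) _; rewrite leq_exp2r // ltnS.
  exact: gate_inputs_degree GI.
apply: leq_trans (_ : #|U| * (D * volume_bound t L K.-1).+1 <= _); last first.
  by rewrite leq_mul2r cU orbT.
rewrite mulnS leq_add2l; apply: leq_trans (_ : #|Y| * volume_bound t L K.-1 <= _).
  by apply: leq_card_bigcup_const => y /hF[].
by rewrite mulnA leq_mul2r card_reach orbT.
Qed.

Lemma near_gball r x : near act (kids K m G 0) (kids K m G 1) r x \subset gball G r x.
Proof.
elim: r x => [|r IH] x /=; first by rewrite setU0 sub1set gball_id.
rewrite subUset sub1set gball_id /=; apply/bigcupsP => y /andP[_ yx].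
apply: subset_trans (IH y) _; apply/subsetP => z; apply: adj_gball.
by case/setUP: yx => /kids_adj.
Qed.

(** The distance splits into 3 inside [U], 1 for the step to a child, and [r] for each of at most
    [K] types. *)
Lemma shallow_mend r : n < 2 ^ r ->
  exists2 lam', @mend Pi n G lam v lam' & @mend_radius Pi n G v lam lam' <= 4 + K * r.
Proof.
move=> nr; have exF y : exists S : {set 'I_n}, y \in Y ->
    [/\ y \in S, strategy t act (kids K m G 0) (kids K m G 1) S &
        S \subset gball G (K * r) y].
  have [yY|nY] := boolP (y \in Y); last by exists set0.
  have [|S [yS sS cS]] := shallow_strategy t0 tm reach_cardA
    reach_tyA reach_tyB reach_inj (r := r) _ (erefl (gtype y)) (kid_off_cycle yY).
    by rewrite card_ord.
  exists S => _; split=> //; apply: subset_trans cS _.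
  apply: subset_trans (near_gball _ _) (gball_le _ _ _).
  by rewrite leq_mul2r gtype_lt orbT.
have [F hF] := fin_all_exists exF.
exists (raise (U :|: \bigcup_(y in Y) F y)).
  apply: raise_mend; last exact: subsetUl.
  by apply: gate_closedU => y /hF[].
apply/bigmax_leqP => u /(subsetP (raise_changed _)) uS; apply: dist_le.
case/setUP: uS => [|/bigcupP[y yY uF]]; first by apply/subsetP/gball_le.
have [_ _ /subsetP/(_ _ uF) uy] := hF y yY; apply: gball_trans uy.
case/bigcupP: yY => x xU yx; apply: gball_adj xU _.
by case/setUP: yx => /kids_adj.
Qed.

End Mend.

Lemma gate_mendable : mendable Pi.
Proof.
move=> n G lam v GI lamP lamv.
have [|lam' h _] := @small_mend _ _ _ v GI lamP n.
  by apply/ltnW/ltn_expl; lia.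
by exists lam'.
Qed.

Lemma EMVol_le n L : n <= m ^ L ->
  EMVol Pi n <= D.+1 ^ 3 * (D * volume_bound t L K.-1).+1.
Proof.
move=> nL; apply/bigmax_leqP => G GI; apply/bigmax_leqP => lam lamP.
apply/bigmax_leqP => v hv.
have [lam' h c] := @small_mend _ _ _ v GI lamP _ nL.
exact: leq_trans (bigminn_le _ _ h) c.
Qed.

Lemma MRad_le n r : n < 2 ^ r -> MRad Pi n <= 4 + K * r.
Proof.
move=> nr; apply/bigmax_leqP => G GI; apply/bigmax_leqP => lam lamP.
apply/bigmax_leqP => v hv.
have [lam' h c] := @shallow_mend _ _ _ v GI lamP _ nr.
exact: leq_trans (bigminn_le _ _ h) c.
Qed.

End GateUpper.

(** * Trees of addresses *)

Section AddressTrees.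
Variables (S : Type) (root : S) (arity : S -> nat) (step : S -> nat -> S).

(* An address lists child indices from the vertex up to the root, so that the
   parent of [c :: a] is [a]. *)
Fixpoint state (a : seq nat) : S := if a is c :: b then step (state b) c else root.

Fixpoint valid (a : seq nat) : bool :=
  if a is c :: b then (c < arity (state b)) && valid b else true.

Fixpoint level (l : nat) : seq (seq nat) :=
  if l is k.+1 then
    flatten [seq [seq c :: a | c <- iota 0 (arity (state a))] | a <- level k]
  else [:: [::]].

Fixpoint upto (N : nat) : seq (seq nat) := if N is k.+1 then upto k ++ level k else [::].

Lemma mem_level l a : (a \in level l) = (size a == l) && valid a.
Proof.
elim: l a => [|l IH] a; first by rewrite inE; case: a.
apply/flatten_mapP/idP => [[b]|].
  by rewrite IH => /andP[/eqP sb vb] /mapP[c]; rewrite mem_iota /= => cb ->;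
    rewrite /= sb eqxx cb vb.
case: a => [|c b] //= /and3P[sb cb vb]; exists b; first by rewrite IH -eqSS sb.
by apply/mapP; exists c => //; rewrite mem_iota.
Qed.

Lemma mem_upto N a : (a \in upto N) = (size a < N) && valid a.
Proof.
elim: N => [|N IH] //=; rewrite mem_cat IH mem_level -andb_orl; congr andb.
by rewrite ltnS [RHS]leq_eqVlt orbC.
Qed.

Lemma level_uniq l : uniq (level l).
Proof.
elim: l => //= l IH; apply: (@allpairs_uniq_dep (seq nat) (fun=> nat) _ (fun a c => c :: a)) => //.
  by move=> a _; apply: iota_uniq.
by move=> [a c] [b d] _ _ /= [-> ->].
Qed.

Lemma upto_uniq N : uniq (upto N).
Proof.
elim: N => //= N IH; rewrite cat_uniq IH level_uniq andbT.
apply/hasPn => a; rewrite mem_level mem_upto => /andP[/eqP-> _].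
by rewrite ltnn.
Qed.

Lemma count_upto P N : count P (upto N) = \sum_(l < N) count P (level l).
Proof. by elim: N => [|N IH]; rewrite ?big_ord0 // big_ord_recr /= count_cat IH. Qed.

Lemma count_levelS P l : count P (level l.+1) =
  \sum_(a <- level l) count (fun c => P (c :: a)) (iota 0 (arity (state a))).
Proof.
rewrite /= count_flatten -map_comp sumnE big_map; apply: eq_bigr => a _.
by rewrite /= count_map.
Qed.

Definition nbrs (a : seq nat) : seq (seq nat) :=
  (if a is _ :: b then [:: b] else [::]) ++ [seq c :: a | c <- iota 0 (arity (state a))].

Definition up (a b : seq nat) : bool := (b != [::]) && (behead b == a).
Definition adjA (a b : seq nat) : bool := up a b || up b a.

Lemma up_size a b : up a b -> size b = (size a).+1.
Proof. by case: b => // c b /eqP /= ->. Qed.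

Lemma upE a b : up a b -> exists c, b = c :: a.
Proof. by case: b => // c b /eqP /= ->; exists c. Qed.

Lemma nbrs_uniq a : uniq (nbrs a).
Proof.
rewrite cat_uniq map_inj_uniq ?iota_uniq ?andbT; last by move=> x y [].
case: a => [|d b] /=; first by apply/hasPn.
apply/hasPn => x /mapP[c _ ->]; rewrite inE; apply/eqP => /(congr1 size) /=.
lia.
Qed.

Lemma mem_nbrs a b : valid a -> valid b -> (b \in nbrs a) = adjA a b.
Proof.
move=> va vb; rewrite mem_cat orbC /adjA; congr orb; last first.
  by case: a va => // c a _; rewrite inE /up /= eq_sym.
apply/mapP/idP => [[c _ ->]|/upE[c E]]; first by rewrite /up /= eqxx.
by exists c => //; move: vb; rewrite E /= mem_iota => /andP[].
Qed.

Lemma valid_nbrs a b : valid a -> b \in nbrs a -> valid b.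
Proof.
move=> va; rewrite mem_cat => /orP[|/mapP[c]]; last first.
  by rewrite mem_iota /= => ca ->; rewrite /= ca va.
by case: a va => // c a /andP[_ va]; rewrite inE => /eqP->.
Qed.

Variables (N n : nat).
Hypothesis N0 : 0 < N.
Hypothesis sizeN : size (upto N) = n.
Hypothesis valid_size : forall a, valid a -> size a < N.

(** Vertices are numbered by the list of all addresses. Its length is [n], so the default [[::]]
    never occurs out of range. *)
Definition ad (u : 'I_n) : seq nat := nth [::] (upto N) u.

Lemma adV u : valid (ad u).
Proof.
have : ad u \in upto N by rewrite mem_nth // sizeN.
by rewrite mem_upto => /andP[].
Qed.

Lemma ad_inj : injective ad.
Proof.
move=> u w /eqP; rewrite nth_uniq ?upto_uniq ?sizeN // => /eqP.
exact: val_inj.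
Qed.

Lemma adP a : valid a -> exists u, ad u = a.
Proof.
move=> va; have aL : a \in upto N by rewrite mem_upto va valid_size.
have an : index a (upto N) < n by rewrite -sizeN index_mem.
by exists (Ordinal an); rewrite /ad /= nth_index.
Qed.

Lemma card_ad (P : {set 'I_n}) (s : seq (seq nat)) : uniq s -> {in s, forall a, valid a} ->
  (forall u, (u \in P) = (ad u \in s)) -> #|P| = size s.
Proof.
move=> us vs Ps; rewrite cardE -(size_map ad); apply: perm_size.
apply: uniq_perm => //; first by rewrite map_inj_uniq ?enum_uniq //; apply: ad_inj.
move=> a; apply/mapP/idP => [[u]|as_]; first by rewrite mem_enum Ps => h ->.
by have [u ua] := adP (vs a as_); exists u; rewrite // mem_enum Ps ua.
Qed.

Lemma count_ad P : count P (upto N) = #|[set u | P (ad u)]|.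
Proof.
rewrite -size_filter; apply/esym/card_ad.
- by rewrite filter_uniq ?upto_uniq.
- by move=> a; rewrite mem_filter mem_upto => /and3P[].
- by move=> u; rewrite inE mem_filter mem_upto adV valid_size ?adV ?andbT.
Qed.

Definition tree_edges : {set 'I_n * 'I_n} := [set e | adjA (ad e.1) (ad e.2)].

Lemma tree_edgesP : [forall u, forall v,
  ((u, v) \in tree_edges) ==> (u != v) && ((v, u) \in tree_edges)].
Proof.
apply/forallP => u; apply/forallP => v; apply/implyP; rewrite !inE /= => uv.
rewrite /adjA orbC -/(adjA _ _) uv andbT; apply/eqP => E; subst v.
by move: uv; rewrite /adjA orbb => /up_size /n_Sn.
Qed.

Definition tree_graph : sgraph n := SGraph tree_edgesP.

Lemma tree_adj u v : adj tree_graph u v = adjA (ad u) (ad v).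
Proof. by rewrite /adj inE. Qed.

Lemma tree_degree u : degree tree_graph u = (ad u != [::]) + arity (state (ad u)).
Proof.
rewrite /degree (@card_ad _ (nbrs (ad u))) ?nbrs_uniq //.
- by rewrite size_cat size_map size_iota; case: (ad u).
- by move=> a; apply: valid_nbrs; apply: adV.
- by move=> w; rewrite inE tree_adj mem_nbrs ?adV.
Qed.

(** Every vertex is linked to the root by shortening its address. On a cycle, both neighbours of a
    deepest vertex would be its parent and hence equal. *)
Lemma tree_graph_is_tree : is_tree tree_graph.
Proof.
have [r0 r0E] : exists u, ad u = [::] by apply: adP.
have cs := sym_connect_sym (@adj_sym _ tree_graph).
apply/and3P; split.
- exact: leq_ltn_trans (leq0n r0) (ltn_ord r0).
- have toroot u : connect (adj tree_graph) r0 u.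
    have [k] := ubnP (size (ad u)); elim: k u => // k IH u uk.
    case E : (ad u) (adV u) => [|c a]; first by rewrite (@ad_inj u r0) ?connect0 // r0E.
    case/andP => _ /adP[w wa]; apply: connect_trans (IH w _) _.
      by move: uk; rewrite E wa /= ltnS.
    by apply: connect1; rewrite tree_adj /adjA /up E wa /= eqxx.
  apply/forallP => u; apply/forallP => v; apply: connect_trans (toroot v).
  by rewrite cs.
apply/forallP => k; apply/forallP => c; apply/implyP => k2; apply/negP => /andP[cc uc].
have [x0 x0c] : exists x, x \in c.
  by exists (tnth c (Ordinal (ltn_trans (isT : 0 < 2) k2))); apply: mem_tnth.
have [x xc xmax] : exists2 x, x \in c & forall y, y \in c -> size (ad y) <= size (ad x).
  by case: (arg_maxnP (fun x => size (ad x)) x0c) => x xc h; exists x.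
have [i s E] := rot_to xc.
have cyc : cycle (adj tree_graph) (x :: s) by rewrite -E rot_cycle.
have us : uniq (x :: s) by rewrite -E rot_uniq.
have sz : size (x :: s) = k by rewrite -E size_rot size_tuple.
have sc y : y \in s -> y \in c.
  by move=> ys; rewrite -(mem_rot i) E inE ys orbT.
have isup y : y \in c -> adj tree_graph x y -> ad y = behead (ad x).
  move=> yc; rewrite tree_adj => /orP[/up_size h|/andP[_ /eqP //]].
  by have := xmax y yc; rewrite h ltnn.
case: s E cyc us sz sc => [|y s] E; first by move=> _ _ /= sz; lia.
case/lastP: s E => [|s z] E; first by move=> _ _ /= sz; lia.
rewrite /= rcons_path last_rcons => /and3P[xy _ zx] us _ sc.
have yE := isup _ (sc y (mem_head _ _)) xy.
have zE : ad z = behead (ad x).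
  apply: isup; last by rewrite adj_sym.
  by apply: sc; rewrite inE mem_rcons mem_head orbT.
have yz : y = z by apply: ad_inj; rewrite yE zE.
by move: us; rewrite yz mem_rcons mem_head /= andbF.
Qed.

(** Depth changes by one along an edge. The hypothesis covers the default value [n] of [dist]. *)
Lemma tree_dist u v : size (ad v) <= n + size (ad u) ->
  size (ad v) - size (ad u) <= dist tree_graph u v.
Proof.
move=> vn; apply: bigminn_ge => [|d]; first by rewrite leq_subLR addnC.
case/walkP => p [<- pp <-]; rewrite leq_subLR addnC.
elim: p u pp {vn} => //= y p IH u /andP[uy /IH h].
apply: leq_trans h _; rewrite addSnnS leq_add2l.
by move: uy; rewrite tree_adj => /orP[/up_size->|/up_size->] //; lia.
Qed.

End AddressTrees.

(** * Complete trees of gates *)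

Section GateTree.
Variables (K m h : nat).
Hypotheses (m1 : 1 < m) (K0 : 0 < K).

(* [Pad q] lies on the padding path that adjusts the number of vertices, [q] steps
   above the last padding vertex; [Core j i r] is a gate of type [j] and phase [i]
   with [r] levels of gates below it. *)
Inductive node := Pad of nat | Core of nat & nat & nat | Leaf.

Definition core_type (j : nat) (s : node) : bool := if s is Core j' _ _ then j' == j else false.
Definition is_core (s : node) : bool := if s is Core _ _ _ then true else false.

Definition core_root : node := Core K.-1 0 h.

(** With the edge upwards, a core vertex gets degree [m.+2 + 3 * j + i], the code of type [j] and
    phase [i]; leaves fill the remaining places. This is why even the root of the core hangs below a
    padding vertex. *)
Definition arity (s : node) : nat :=
  match s with Pad _ => 1 | Core j i _ => m.+1 + 3 * j + i | Leaf => 0 end.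

Definition step (s : node) (c : nat) : node :=
  match s with
  | Pad 0 => core_root
  | Pad q.+1 => Pad q
  | Core j i r.+1 =>
      if c < m then Core j (i.+1 %% 3) r
      else if (c == m) && (0 < j) then Core j.-1 (i.+1 %% 3) r else Leaf
  | _ => Leaf
  end.

Definition ok (s : node) : bool :=
  match s with Pad _ => false | Core j i _ => (j < K) && (i < 3) | Leaf => true end.

Lemma ok_step s c : ok s -> ok (step s c).
Proof.
case: s => // j i [|r] //= /andP[jK i3]; case: ifP => _.
  by rewrite /= jK ltn_mod.
by case: ifP => //= _; rewrite ltn_mod andbT; apply: leq_ltn_trans (leq_pred j) jK.
Qed.

Lemma ok_root : ok core_root.
Proof. by rewrite /= prednK // leqnn. Qed.

(** Levels with addresses forgotten. The start is an argument so that the levels below the padding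
    path become those of [core_root]. *)
Fixpoint states (s : node) (l : nat) : seq node :=
  if l is k.+1 then
    flatten [seq [seq step s' c | c <- iota 0 (arity s')] | s' <- states s k]
  else [:: s].

Lemma states_level s l : map (state s step) (level s arity step l) = states s l.
Proof.
elim: l => //= l IH; rewrite map_flatten -IH -!map_comp; congr flatten.
by apply: eq_map => a /=; rewrite -map_comp.
Qed.

Lemma states_add s s' a l : states s a = [:: s'] -> states s (a + l) = states s' l.
Proof. by move=> E; elim: l => [|l IH]; rewrite ?addn0 // addnS /= IH. Qed.

Lemma states_pad p : states (Pad p) p.+1 = [:: core_root].
Proof.
elim: p => // p IH.
by rewrite -[p.+2]add1n (@states_add _ (Pad p)).
Qed.

Lemma size_states_pad p l : size (states (Pad p) l) = 1 \/ p < l.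
Proof.
elim: p l => [|p IH] [|l]; [by left|by right|by left|].
rewrite -[l.+1]add1n (@states_add _ (Pad p)) // ltnS.
Qed.

Lemma states_ok l : all ok (states core_root l).
Proof.
elim: l => [|l IH]; first by rewrite /= prednK // leqnn.
rewrite /=; elim: (states core_root l) IH => //= s ss IHs /andP[os oss].
rewrite all_cat IHs // andbT all_map.
by elim: (iota _ _) => //= c cs ->; rewrite ok_step.
Qed.

(** There are [h.+1] levels containing core vertices and a last one of leaves only. *)
Definition core_size : nat := \sum_(l < h.+2) size (states core_root l).

(** A bound on the core children of a vertex. For [K = 1] it has to be exactly [m], as the exponent
    [p / q] compares it with [t]. *)
Definition branching : nat := m + (1 < K).

Lemma count_core_children s : ok s ->
  count (fun c => is_core (step s c)) (iota 0 (arity s)) <= branching * is_core s.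
Proof.
case: s => [//|j i r|//] /andP[jK i3].
have -> : branching * is_core (Core j i r) = branching by rewrite muln1.
rewrite -size_filter -[branching](size_iota 0 branching); apply: uniq_leq_size.
  by rewrite filter_uniq // iota_uniq.
move=> c; rewrite mem_filter !mem_iota /= add0n => /andP[+ _].
case: r => // r; rewrite /branching; case: (ltnP c m) => [cm _|mc].
  exact: leq_trans cm (leq_addr _ _).
case: ifP => // /andP[/eqP -> j0] _.
have -> : 1 < K by exact: leq_ltn_trans j0 jK.
by rewrite addn1.
Qed.

Lemma count_core_states l : count is_core (states core_root l) <= branching ^ l.
Proof.
elim: l => //= l IH; rewrite expnS.
apply: leq_trans (_ : branching * count is_core (states core_root l) <= _); last first.
  by rewrite leq_mul2l IH orbT.
rewrite count_flatten -map_comp.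
elim: (states _ _) (states_ok l) => //= s ss IHs /andP[os oss].
by rewrite mulnDr; apply: leq_add (IHs oss); rewrite count_map; apply: count_core_children.
Qed.

(** Only core vertices have children here, and at most [m.+1 + 3 * K.-1 + 2] each. *)
Lemma size_statesS l :
  size (states core_root l.+1) <= (m + 3 * K) * branching ^ l.
Proof.
apply: leq_trans (_ : (m + 3 * K) * count is_core (states core_root l) <= _); last first.
  by rewrite leq_mul2l count_core_states orbT.
rewrite /= size_flatten /shape -map_comp.
elim: (states _ _) (states_ok l) => //= s ss IHs /andP[os oss].
rewrite mulnDr; apply: leq_add (IHs oss); rewrite size_map size_iota.
by case: s os => //= j i _ /andP[]; lia.
Qed.

Lemma core_size_le : core_size <= (m + 3 * K) * branching ^ h.+1.
Proof.
rewrite /core_size big_ord_recl /=.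
apply: leq_trans (_ : 1 + \sum_(l < h.+1) (m + 3 * K) * branching ^ l <= _).
  by rewrite leq_add2l; apply: leq_sum => l _; apply: size_statesS.
rewrite -big_distrr /=.
have b2 : 1 < branching by apply: leq_trans m1 (leq_addr _ _).
have : \sum_(l < h.+1) branching ^ l < branching ^ h.+1.
  elim: h.+1 => [|k IH]; first by rewrite big_ord0.
  rewrite big_ord_recr expnS /=; move: IH b2; set x := \sum_(_ < _) _.
  by set y := branching ^ k; nia.
set x := \sum_(_ < _) _; set y := branching ^ _; nia.
Qed.

(** * Padding the tree to a given number of vertices *)

Section Pads.
Variables (p n : nat).
Hypothesis size_n : p.+1 + core_size = n.

Local Notation st := (state (Pad p) step).
Local Notation vd := (valid (Pad p) arity step).
Local Notation lv := (level (Pad p) arity step).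
Let N := p.+1 + h.+2.

Lemma size_lv l : size (lv l) = size (states (Pad p) l).
Proof. by rewrite -states_level size_map. Qed.

Lemma size_upto : size (upto (Pad p) arity step N) = n.
Proof.
rewrite -count_predT count_upto.
under eq_bigr => l _ do rewrite count_predT size_lv.
rewrite /N big_split_ord /= -size_n; congr addn.
  rewrite -[RHS]card_ord -sum1_card; apply: eq_bigr => i _.
  by case: (size_states_pad p i) => // pi; have := ltn_ord i; lia.
by apply: eq_bigr => i _; exact: (congr1 size (states_add _ (states_pad p))).
Qed.

(** The height of the subtree below a vertex of this state; it drops along every edge downwards and
    so bounds the length of addresses. *)
Definition fuel (s : node) : nat :=
  match s with Pad q => q + h.+2 | Core _ _ r => r.+1 | Leaf => 0 end.

Lemma valid_fuel a : vd a -> size a + fuel (st a) <= p + h.+2.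
Proof.
elim: a => //= c a IH /andP[ca /IH]; apply: leq_trans.
rewrite addSnnS leq_add2l; move: ca; case: (st a) => //= [[|q]|j i [|r]] //=.
by move=> _; case: ifP => // _; case: ifP.
Qed.

Lemma valid_N a : vd a -> size a < N.
Proof. by move/valid_fuel => h1; rewrite /N addSn ltnS; apply: leq_trans (leq_addr _ _) h1. Qed.

Lemma core_depth a j i r : vd a -> st a = Core j i r -> size a + r = p.+1 + h.
Proof.
suff gen : vd a -> match st a with Pad q => size a + q = p
    | Core _ _ r => size a + r = p.+1 + h | Leaf => True end.
  by move=> /gen + E; rewrite E.
elim: a => //= c a IH /andP[ca /IH]; case: (st a) => //= [[|q]|j' i' [|r']] //=.
- by rewrite addn0 => ->.
- by rewrite addSnnS.
- by case: ifP => _ /=; [|case: ifP => _ //=]; rewrite -addSnnS.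
Qed.

Lemma core_ok a j i r : vd a -> st a = Core j i r -> (j < K) && (i < 3).
Proof.
suff gen : vd a -> if st a is Pad _ then true else ok (st a).
  by move=> /gen + E; rewrite E.
elim: a => // c a IH /andP[_ /IH]; rewrite -[st (c :: a)]/(step (st a) c).
case: (st a) => [[|q] _|j' i' r'|//] //; first exact: ok_root.
by move=> /(ok_step c); case: (step _ _).
Qed.

Lemma pad_nseq a q : vd a -> st a = Pad q -> q <= p /\ a = nseq (p - q) 0.
Proof.
elim: a q => [|c a IH] q /=; first by move=> _ [->]; rewrite subnn.
case/andP => ca va; case E : (st a) ca => [[|q']|j i [|r]|] //=; last first.
  by move=> _; case: ifP => // _; case: ifP.
move=> c0 [<-]; have [qp ->] := IH _ va E; split; first exact: ltnW.
have -> : c = 0 by move: c0; rewrite ltnS leqn0 => /eqP.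
by rewrite -[0 :: _]/(nseq (p - q'.+1).+1 0) subnSK.
Qed.

Lemma nseq_pad i : i <= p -> vd (nseq i 0) /\ st (nseq i 0) = Pad (p - i).
Proof.
elim: i => [|i IH] ip /=; first by rewrite subn0.
have [-> ->] := IH (ltnW ip); split=> //=.
by rewrite -[p - i]prednK ?subn_gt0 //= subnS.
Qed.

Definition core_addr := nseq p.+1 0.

Lemma core_addr_valid : vd core_addr.
Proof. by have [/= -> ->] := nseq_pad (leqnn p); rewrite subnn. Qed.

Lemma core_addr_state : st core_addr = core_root.
Proof. by have [_ /= ->] := nseq_pad (leqnn p); rewrite subnn. Qed.

Lemma N_gt0 : 0 < N. Proof. by []. Qed.

Definition gtree : sgraph n := tree_graph (Pad p) arity step N n.

Definition addr (u : 'I_n) : seq nat := ad (Pad p) arity step N u.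

Lemma addrV u : vd (addr u). Proof. exact: adV size_upto u. Qed.
Lemma addr_inj : injective addr. Proof. exact: ad_inj size_upto. Qed.
Lemma addrP a : vd a -> exists u, addr u = a.
Proof. exact: adP size_upto valid_N a. Qed.
Lemma gtree_adj u v : adj gtree u v = adjA (addr u) (addr v).
Proof. exact: tree_adj. Qed.

Lemma gtree_degree u : degree gtree u = (addr u != [::]) + arity (st (addr u)).
Proof. exact: tree_degree size_upto valid_N u. Qed.

Lemma gtree_tree : is_tree gtree.
Proof. exact: tree_graph_is_tree N_gt0 size_upto valid_N. Qed.

Lemma degree_core u j i r : st (addr u) = Core j i r ->
  [/\ gate_degree K m (degree gtree u), gate_type m (degree gtree u) = j &
      gate_phase m (degree gtree u) = i].
Proof.
move=> E; have := core_ok (addrV u) E; rewrite gtree_degree E /=.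
have -> /= : addr u != [::] by apply/eqP => E'; rewrite E' in E.
rewrite /gate_degree /gate_type /gate_phase => /andP[jK i3].
have -> : 1 + (m.+1 + 3 * j + i) - m.+2 = j * 3 + i by lia.
by rewrite divnMDl // divn_small // addn0 modnMDl modn_small //; split=> //; lia.
Qed.

Lemma degree_gate u : gate_degree K m (degree gtree u) -> is_core (st (addr u)).
Proof.
rewrite gtree_degree /gate_degree; case: (st _) => //= [q|].
  by case: (addr u != [::]); lia.
by case: (addr u != [::]); lia.
Qed.

Lemma gtree_max_degree : max_degree gtree <= m.+1 + 3 * K.
Proof.
apply/bigmax_leqP => u _; rewrite gtree_degree.
case E : (st (addr u)) => [q|j i r|] /=.
- by case: (addr u != [::]); lia.
- have := core_ok (addrV u) E.
  by case: (addr u != [::]); lia.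
- by case: (addr u != [::]); lia.
Qed.

Local Notation parentsG := (parents K m gtree).
Local Notation kidsG := (kids K m gtree).

(** A parent below [u] would have both the phase after and the phase before that of [u], impossible
    modulo 3. *)
Lemma parents_up u w : w \in parentsG u ->
  [/\ up (addr w) (addr u), is_core (st (addr w)) & is_core (st (addr u))].
Proof.
rewrite inE gtree_adj => /andP[uw /and4P[gw gu ph _]].
have [cw cu] := (degree_gate gw, degree_gate gu); split=> //.
case/orP: uw => // /upE[c wE]; exfalso.
case E : (st (addr u)) cu => [|j i r|] // _.
have [_ _ pu] := degree_core E; have /andP[_ i3] := core_ok (addrV u) E.
move: cw; rewrite wE /= E; case E' : (step _ _) => [|j' i' r'|] // _.
have i'E : i' = i.+1 %% 3.
  by case: r E E' => // r E /=; case: ifP => _; [case|case: ifP => _ // []] => *.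
have [|_ _ pw] := @degree_core w j' i' r'; first by rewrite wE /= E E'.
by move: ph; rewrite pu pw i'E; case: i i3 {E E' pu i'E pw} => [|[|[|]]].
Qed.

Lemma parents_core u w c : addr u = c :: addr w ->
  is_core (st (addr w)) -> is_core (st (addr u)) -> parentsG u = [set w].
Proof.
move=> uE cw cu; apply/setP => w'; rewrite in_set1; apply/idP/eqP => [|->].
  case/parents_up => /andP[_ /eqP]; rewrite uE /= => /addr_inj -> //.
rewrite inE gtree_adj uE /adjA {2}/up /= eqxx orbT /=.
case E : (st (addr w)) cw => [|j i r|] // _.
have [gw tw pw] := degree_core E.
move: cu; rewrite uE /= E; case E' : (step _ _) => [|j' i' r'|] // _.
have [|gu tu pu] := @degree_core u j' i' r'; first by rewrite uE /= E E'.
rewrite /feeds gw gu pw pu tw tu.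
case: r E E' => // r E /=; case: ifP => _; first by case=> <- <- _; rewrite !eqxx.
by case: ifP => // /andP[_ j0] [<- <- _]; rewrite prednK // !eqxx orbT.
Qed.

Lemma kids0E w j i r : st (addr w) = Core j i r.+1 ->
  forall u, (u \in kidsG 0 w) = (addr u \in [seq c :: addr w | c <- iota 0 m]).
Proof.
move=> E u; have [_ tw _] := degree_core E; rewrite inE addn0 tw.
apply/andP/mapP => [[/eqP pu /eqP tu]|[c]].
  have /parents_up[/upE[c uE] _ cu] : w \in parentsG u by rewrite pu inE.
  exists c => //; rewrite mem_iota /= add0n; case: ltnP => // mc.
  move: cu; rewrite uE /= E /= ltnNge mc /=; case: ifP => // /andP[cm j0] _.
  have [|_ tu' _] := @degree_core u j.-1 (i.+1 %% 3) r.
    by rewrite uE /= E /= ltnNge mc /= cm j0.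
  by move: tu; rewrite tu'; lia.
rewrite mem_iota /= add0n => cm uE.
have uS : st (addr u) = Core j (i.+1 %% 3) r by rewrite uE /= E /= cm.
have [_ -> _] := degree_core uS; split=> //.
by rewrite (parents_core uE) ?E ?uS.
Qed.

Lemma kids1E w j i r u : st (addr w) = Core j i r.+1 ->
  (u \in kidsG 1 w) = (addr u == m :: addr w) && (0 < j).
Proof.
move=> E; have [_ tw _] := degree_core E; rewrite inE addn1 tw.
apply/andP/andP => [[/eqP pu /eqP tu]|[/eqP uE j0]].
  have /parents_up[/upE[c uE] _ cu] : w \in parentsG u by rewrite pu inE.
  split; last by rewrite -tu.
  move: cu; rewrite uE /= E /=; case: ifP => [cm|_].
    have [|_ tu' _] := @degree_core u j (i.+1 %% 3) r; first by rewrite uE /= E /= cm.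
    by move: tu; rewrite tu'; lia.
  by case: ifP => // /andP[/eqP -> _].
have uS : st (addr u) = Core j.-1 (i.+1 %% 3) r by rewrite uE /= E /= ltnn eqxx j0.
have [_ -> _] := degree_core uS; split; last by rewrite prednK.
by rewrite (parents_core uE) ?E ?uS.
Qed.

Lemma gate_core w j i r : st (addr w) = Core j i r.+1 -> gate K m gtree w.
Proof.
move=> E; apply/andP; split.
  rewrite (card_ad size_upto valid_N _ _ (kids0E E)) ?size_map ?size_iota //.
    by rewrite map_inj_uniq ?iota_uniq // => x y [].
  move=> a /mapP[c]; rewrite mem_iota /= add0n => cm -> /=.
  by rewrite addrV andbT E /=; lia.
apply/card_le1_eqP => x y; rewrite !(kids1E _ E) => /andP[/eqP xE _] /andP[/eqP yE _].
by apply: addr_inj; rewrite xE yE.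
Qed.

(** Having children, such a gate is a core vertex; the vertex above it would be its parent unless it
    is padding, which leaves only the root of the core. *)
Lemma gate_orphan w : gate K m gtree w -> parentsG w = set0 -> addr w = core_addr.
Proof.
case/andP => /eqP k0 _ pw.
have [y] : exists y, y \in kidsG 0 w by apply/card_gt0P; rewrite k0; lia.
rewrite inE => /andP[/eqP py _].
have /parents_up[_ cw _] : w \in parentsG y by rewrite py inE.
case E : (addr w) (addrV w) cw => [//|c a] va cw.
have vc := va; case/andP: va => ca /addrP[z za].
have cz : ~~ is_core (st a).
  apply/negP => cz; have := @parents_core w z c; rewrite E za pw => /(_ erefl).
  rewrite cz cw => /(_ isT isT)/setP/(_ z).
  by rewrite !inE eqxx.
move: cw ca cz => /=; case Ea : (st a) => [[|q]|j i r|] // _ c1 _.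
have va : vd a by case/andP: vc.
have [_ ->] := pad_nseq va Ea; rewrite subn0 /core_addr.
by move: c1; rewrite ltnS leqn0 => /eqP ->.
Qed.

End Pads.
End GateTree.

(** * Lower bounds for the gate problem *)

Section GateLower.
Variables (K m t h : nat).
Hypotheses (t0 : 0 < t) (tm : t < m) (K0 : 0 < K).
Variables (C : graph_class) (C_iso : iso_closed C).
Hypothesis C_tree : forall n (G : sgraph n), is_tree G -> C G.
Local Notation Pi := (gate_problem K m t C_iso).

Let m1 : 1 < m := leq_ltn_trans t0 tm.

Section Instance.
Variables (p n : nat).
Hypothesis size_n : p.+1 + core_size K m h = n.

Local Notation st := (state (Pad p) (step K m h)).
Local Notation vd := (valid (Pad p) (arity m) (step K m h)).
Local Notation lv := (level (Pad p) (arity m) (step K m h)).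
Local Notation N := (p.+1 + h.+2).
Local Notation G := (@gtree K m h p n).
Local Notation addr := (@addr K m h p n).

Lemma gtree_inputs : inputs Pi G.
Proof. by apply/andP; split; [apply/C_tree/gtree_tree|apply: gtree_max_degree]. Qed.

Variable root : 'I_n.
Hypothesis addr_root : addr root = core_addr p.

(* Vertices without parents have to be lit; [root] is the only gate among them. *)
Definition unlit : labeling bool n :=
  [ffun u => if u == root then None else Some (parents K m G u == set0)].

Lemma parents_root : parents K m G root = set0.
Proof.
apply/setP => w; rewrite [RHS]inE; apply/negP => /(parents_up m1 K0 size_n)[].
rewrite addr_root => /andP[_ /eqP /= <-].
by have [_ ->] := nseq_pad K m h (leqnn p); rewrite subnn.
Qed.

Lemma unlit_partial : @partial_solution Pi n G unlit.
Proof.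
apply/forallP => w; apply/implyP => /forall_inP hw.
have wr : w != root.
  by have := hw w (gball_id _ _ _); apply: contra => /eqP ->; rewrite /hole ffunE eqxx.
rewrite /= /gate_happy ffunE (negbTE wr).
have [pw|//] := eqVneq (parents K m G w) set0.
rewrite eqxx; apply/implyP => gw; case/eqP: wr.
by apply: (addr_inj m1 K0 size_n); rewrite addr_root (gate_orphan m1 K0 size_n gw pw).
Qed.

Lemma unlit_hole : @hole Pi n unlit root.
Proof. by rewrite /hole ffunE eqxx. Qed.

Variable lam : labeling bool n.
Hypothesis lam_mend : @mend Pi n G unlit root lam.

Definition lit (a : seq nat) : bool := [exists u, (addr u == a) && (lam u == Some true)].

Lemma lit_addr u : lit (addr u) = (lam u == Some true).
Proof.
apply/existsP/idP => [[w /andP[/eqP/(addr_inj m1 K0 size_n)->]]|h'] //.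
by exists u; rewrite eqxx.
Qed.

(** The only hole of [unlit] is [root], which a mend fills, so every vertex is checked. *)
Lemma lam_happy u : gate_happy K m t G lam u.
Proof.
case/and3P: lam_mend => /forallP/(_ u)/implyP h' hr /forallP hl.
apply: h'; apply/forall_inP => w _; have := hl w; rewrite {1}/hole ffunE.
by have [-> _|_ /implyP] := eqVneq w root; last apply.
Qed.

Lemma lit_root : lit (core_addr p).
Proof.
have := lam_happy root; rewrite -addr_root lit_addr /gate_happy.
by case: ifP => // _; rewrite parents_root eqxx.
Qed.

(** The root was a hole; every other core vertex has the one above it as a parent and was labelled
    [Some false]. *)
Lemma lit_changed u : lit (addr u) -> is_core (st (addr u)) -> u \in @changed Pi n unlit lam.
Proof.
rewrite lit_addr inE ffunE => /eqP-> cu; have [//|ur] := eqVneq u root.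
suff /negbTE -> : parents K m G u != set0 by [].
case E : (addr u) cu => [//|c a] cu.
have /andP[ca va] : vd (c :: a) by rewrite -E (addrV m1 K0 size_n).
case Ea : (st a) => [q|j i r|]; last by rewrite Ea in ca.
  have [_ aE] := pad_nseq va Ea; case: q Ea aE => [|q] Ea aE; last first.
    by move: cu; rewrite /= Ea.
  case/eqP: ur; apply: (addr_inj m1 K0 size_n); rewrite addr_root E aE subn0.
  by move: ca; rewrite Ea ltnS leqn0 => /eqP ->.
have [w wa] := addrP m1 K0 size_n va.
rewrite (@parents_core _ _ _ m1 K0 _ _ size_n u w c) ?wa ?Ea ?E //.
by apply/set0Pn; exists w; rewrite inE.
Qed.

Definition lit_count (j l : nat) : nat :=
  count (fun a => lit a && core_type j (st a)) (lv (p.+1 + l)).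

Lemma lit_kids a j i r : vd a -> lit a -> st a = Core j i r.+1 ->
  t <= count (fun c => lit (c :: a)) (iota 0 m) /\ (0 < j -> lit (m :: a)).
Proof.
move=> va; have [w <-] := addrP m1 K0 size_n va; rewrite lit_addr => lw E.
have := lam_happy w; rewrite /gate_happy lw.
rewrite (gate_core m1 K0 size_n E) /= => /andP[h1 /forall_inP h2].
have ar : arity m (st (addr w)) = m.+1 + 3 * j + i by rewrite E.
split; last first.
  move=> j0; have [u uE] : exists u, addr u = m :: addr w.
    by apply: (addrP m1 K0 size_n); rewrite /= ar (addrV m1 K0 size_n) andbT; lia.
  by rewrite -uE lit_addr h2 // (kids1E m1 K0 size_n _ E) uE eqxx.
apply: leq_trans h1 _; rewrite -size_filter -(size_map (fun c => c :: addr w)).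
rewrite (card_ad (size_upto m1 K0 size_n) (@valid_N K m h p)
  (s := [seq c :: addr w | c <- iota 0 m & lit (c :: addr w)])).
- by [].
- by rewrite map_inj_uniq ?filter_uniq ?iota_uniq // => x y [].
- move=> b /mapP[c]; rewrite mem_filter mem_iota /= add0n => /andP[_ cm] -> /=.
  by rewrite ar (addrV m1 K0 size_n) andbT; lia.
move=> u; rewrite in_set (kids0E m1 K0 size_n E).
apply/andP/mapP => [[/mapP[c cm uE] lu]|[c]].
  by exists c; rewrite // mem_filter -uE lit_addr lu cm.
rewrite mem_filter => /andP[lc cm] uE; split; last by rewrite -lit_addr /addr uE.
by apply/mapP; exists c.
Qed.

(* Iterating this inequality yields the binomial coefficients of [lit_count_ge]. *)
Lemma lit_countS j l : l < h -> t * lit_count j l + lit_count j.+1 l <= lit_count j l.+1.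
Proof.
have sum_count (P : pred (seq nat)) s : count P s = \sum_(a <- s) P a.
  by elim: s => [|a s IH]; rewrite ?big_nil // big_cons -IH.
move=> lh; rewrite /lit_count addnS count_levelS !sum_count.
set s := lv _; rewrite big_distrr -big_split /=.
rewrite big_seq_cond [X in _ <= X]big_seq_cond; apply: leq_sum => a.
rewrite andbT mem_level => /andP[/eqP sa va]; rewrite {s}.
have [la|_] := boolP (lit a); last by rewrite muln0.
case E : (st a) => [q|j' i r|]; [by rewrite muln0| |by rewrite muln0].
have -> : arity m (Core j' i r) = m + (1 + 3 * j' + i) by rewrite /=; lia.
rewrite /=.
have := core_depth va E; rewrite sa => /eqP; rewrite -addnA eqn_add2l.
case: r E => [|r] E; first by rewrite addn0 (ltn_eqF lh).
move=> _; have [h1 h2] := lit_kids va la E.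
(* Lit vertices of type [j] account for the term with the factor [t], those of type [j.+1] for the
   other one. *)
have [->|jj'] := eqVneq j' j.
  rewrite muln1 (ltn_eqF (ltnSn j)) addn0.
  rewrite iotaD count_cat; apply: leq_trans (leq_addr _ _).
  apply: leq_trans h1 _; apply/eq_leq/eq_in_count => c.
  by rewrite mem_iota /= add0n => cm; rewrite cm /= eqxx andbT.
rewrite muln0 add0n; case: eqVneq => [jE|_] //=; rewrite -has_count; apply/hasP; exists m.
  by rewrite mem_iota /=; lia.
by rewrite h2 ?jE // ltnn eqxx /= eqxx.
Qed.

(** The binomial chooses which [d] of the [l] steps descend to a lower type; each other step
    multiplies by [t]. The induction is Pascal's rule. *)
Lemma lit_count_ge d l : d < K -> l <= h -> 'C(l, d) * t ^ (l - d) <= lit_count (K.-1 - d) l.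
Proof.
elim: l d => [|l IH] d dK lh.
  case: d dK => [|d] _; last by rewrite bin0n.
  rewrite bin0 sub0n expn0 subn0 /lit_count addn0 -has_count; apply/hasP.
  exists (core_addr p); first by rewrite mem_level size_nseq eqxx core_addr_valid.
  by rewrite lit_root core_addr_state /= eqxx.
apply: leq_trans (lit_countS _ lh).
have IH0 := IH d dK (ltnW lh).
case: d dK IH0 => [|d] dK IH0.
  apply: leq_trans (leq_addr _ _); move: IH0; rewrite !bin0 !subn0 !mul1n expnS.
  by move=> IH0; rewrite leq_mul2l IH0 orbT.
have := IH d (ltnW dK) (ltnW lh).
have -> : K.-1 - d = (K.-1 - d.+1).+1 by lia.
move=> IH1; rewrite binS subSS mulnDl; apply: leq_add IH1.
have [ld|dl] := ltnP l d.+1; first by rewrite bin_small.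
have -> : l - d = (l - d.+1).+1 by lia.
by rewrite expnS mulnCA leq_mul2l IH0 orbT.
Qed.

(** The lowest type alone has the right order of magnitude, so only [d = K.-1] is counted. *)
Lemma volume_ge : \sum_(l < h.+1) 'C(l, K.-1) * t ^ (l - K.-1) <= @mend_volume Pi n unlit lam.
Proof.
pose P a := lit a && is_core (st a).
have : #|[set u | P (addr u)]| <= @mend_volume Pi n unlit lam.
  apply: subset_leq_card; apply/subsetP => u; rewrite inE => /andP[].
  exact: lit_changed.
apply: leq_trans.
rewrite -(count_ad (size_upto m1 K0 size_n) (@valid_N K m h p)) count_upto.
(* The levels of the padding path are dropped, and then the last level, which has only leaves. *)
rewrite big_split_ord /=; apply: leq_trans (leq_addl _ _).
rewrite [X in _ <= X]big_ord_recr /=; apply: leq_trans (leq_addr _ _).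
apply: leq_sum => l _; have lh : l <= h by rewrite -ltnS.
have K1 : K.-1 < K by rewrite prednK.
apply: leq_trans (lit_count_ge K1 lh) _; apply: sub_count => a /andP[la].
by rewrite /P la; case: (st a).
Qed.

(** Counting the top type at level [h] yields a lit core vertex at depth [h] below [root]. *)
Lemma radius_ge : h <= n -> h <= @mend_radius Pi n G root unlit lam.
Proof.
move=> hn; have : 0 < lit_count (K.-1 - 0) h.
  by apply: leq_trans (lit_count_ge K0 (leqnn h)); rewrite bin0 mul1n expn_gt0 t0.
rewrite /lit_count -has_count => /hasP[a].
rewrite mem_level => /andP[/eqP sa va] /andP[la ca].
have [u ua] := addrP m1 K0 size_n va.
have uc : u \in @changed Pi n unlit lam.
  by apply: lit_changed; rewrite ua //; case: (st a) ca.
rewrite /mend_radius (bigD1 u uc) /=; apply: leq_trans (leq_maxl _ _).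
have sr : size (addr root) = p.+1 by rewrite addr_root size_nseq.
have := @tree_dist _ (Pad p) (arity m) (step K m h) N n
  (ltn0Sn _) (size_upto m1 K0 size_n) root u.
rewrite -/(addr root) -/(addr u) sr ua sa addKn; apply.
by rewrite addnC leq_add2r.
Qed.

End Instance.

Lemma lower_bounds n : core_size K m h < n -> h <= n ->
  h <= MRad Pi n /\ \sum_(l < h.+1) 'C(l, K.-1) * t ^ (l - K.-1) <= EMVol Pi n.
Proof.
move=> cn hn; pose p := n - (core_size K m h).+1.
have size_n : p.+1 + core_size K m h = n by rewrite /p; lia.
have [root rE] := addrP m1 K0 size_n (core_addr_valid K m h p).
have GI := gtree_inputs size_n; have lP := unlit_partial size_n rE.
have lh : @hole Pi n (unlit p root) root by exact: unlit_hole.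
have [lam0 h0] := gate_mendable t0 tm K0 GI lP lh.
split.
  apply: leq_trans (leq_bigmax_cond _ GI).
  apply: leq_trans (leq_bigmax_cond _ lP).
  apply: leq_trans (leq_bigmax_cond _ lh).
  by apply: bigminn_ge => // lam hlam; apply: radius_ge hlam hn.
apply: leq_trans (leq_bigmax_cond _ GI).
apply: leq_trans (leq_bigmax_cond _ lP).
apply: leq_trans (leq_bigmax_cond _ lh).
apply: bigminn_ge => [|lam hlam]; last exact: volume_ge hlam.
(* The bound must not exceed the default value [n] of the minimum; the volume of any actual mend
   shows this. *)
apply: leq_trans (volume_ge size_n rE h0) _.
by apply: leq_trans (max_card _) _; rewrite card_ord.
Qed.
End GateLower.

(** * Asymptotics *)

(** The hockey-stick identity. *)
Lemma sum_bin n d : \sum_(l < n) 'C(l, d) = 'C(n, d.+1).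
Proof.
elim: n => [|n IH]; first by rewrite big_ord0.
by rewrite big_ord_recr /= IH binS.
Qed.

Lemma leq_expn m n e : m <= n -> m ^ e <= n ^ e.
Proof. by case: e => // e mn; rewrite leq_exp2r. Qed.

Lemma ffact_ge n k : (n - k) ^ k <= n ^_ k.
Proof.
elim: k => // k IH; rewrite ffactnSr expnSr.
have sub : n - k.+1 <= n - k by apply: leq_sub2l.
apply: leq_mul => //; apply: leq_trans IH; exact: leq_expn.
Qed.

(** Each of the [k] factors of the falling factorial is at least [h / 2]. *)
Lemma bin_ge h k : 2 * k <= h -> h ^ k <= (2 ^ k * k`!) * 'C(h.+1, k).
Proof.
move=> kh; rewrite -mulnA [k`! * _]mulnC bin_ffact.
apply: leq_trans (_ : 2 ^ k * (h.+1 - k) ^ k <= _); last by rewrite leq_mul2l ffact_ge orbT.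
by rewrite -expnMn; apply: leq_expn; lia.
Qed.

Lemma geom_le t L : 1 < t -> geom t L <= t ^ L.
Proof.
move=> t1; elim: L => [|L IH]; first by rewrite /geom big_ord0.
rewrite /geom big_ord_recr /= -/(geom t L) expnS; apply: leq_trans (_ : t ^ L + t ^ L <= _).
  by rewrite leq_add2r.
by rewrite addnn -mul2n leq_mul2r t1 orbT.
Qed.

Lemma geom1 L : geom 1 L = L.
Proof.
rewrite /geom -[RHS]card_ord -sum1_card; apply: eq_bigr => i _.
by rewrite exp1n.
Qed.

Lemma volume_bound1 L j : volume_bound 1 L j < (L + 2) ^ j.+1.
Proof.
elim: j => [|j IH] /=; first by rewrite geom1 mul1n exp1n expn1; lia.
rewrite geom1 exp1n expnS; move: IH; set v := volume_bound 1 L j; set w := (L + 2) ^ _.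
nia.
Qed.

(** The depth is the largest for which the size bound of the core stays below [n]; maximality gives
    the last inequality. *)
Lemma depth_choice B mu h0 n : 1 < mu -> 0 < B -> B * mu ^ h0.+1 < n ->
  exists h, [/\ h0 <= h, B * mu ^ h.+1 < n, h <= n & n <= B * mu ^ h.+2].
Proof.
(* Using [n.-1] turns the strict bound into the weak one that [trunc_log] provides. *)
move=> mu1 B0 hn; set k := trunc_log mu (n.-1 %/ B).
have hk : h0.+1 <= k.
  by apply: trunc_log_max => //; rewrite leq_divRL // mulnC; lia.
have kE : k.-1.+1 = k by apply: prednK; lia.
have q0 : 0 < n.-1 %/ B.
  rewrite divn_gt0 //; have : 0 < mu ^ h0.+1 by rewrite expn_gt0; lia.
  by nia.
have kn : B * mu ^ k < n.
  have := trunc_logP mu1 q0; rewrite -/k leq_divRL // mulnC => h1.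
  apply: leq_ltn_trans h1 _; lia.
exists k.-1; rewrite kE; split=> //; first lia.
  have : k < mu ^ k by apply: ltn_expl.
  by nia.
have := trunc_log_ltn (n.-1 %/ B) mu1; rewrite -/k ltn_divLR // mulnC; lia.
Qed.

Section Family.
Variables (K m t : nat).
Hypotheses (t0 : 0 < t) (tm : t < m) (K0 : 0 < K).
Variables (C : graph_class) (C_iso : iso_closed C).
Hypothesis C_tree : forall n (G : sgraph n), is_tree G -> C G.
Local Notation Pi := (gate_problem K m t C_iso).
Local Notation B := (m + 3 * K).

Lemma gate_lower h0 n : B * branching K m ^ h0.+1 < n ->
  exists h, [/\ h0 <= h, n <= B * branching K m ^ h.+2, h <= MRad Pi n &
    \sum_(l < h.+1) 'C(l, K.-1) * t ^ (l - K.-1) <= EMVol Pi n].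
Proof.
have m1 : 1 < m by apply: leq_ltn_trans t0 tm.
move=> /depth_choice[||h [h0h Bn hn nB]].
- exact: leq_trans m1 (leq_addr _ _).
- lia.
have [|//|h1 h2] := lower_bounds t0 tm K0 C_iso C_tree (h := h) (n := n).
  exact: leq_ltn_trans (core_size_le h m1 K0) Bn.
by exists h.
Qed.

End Family.

From mathcomp Require Import all_algebra.
From mathcomp Require Import all_classical all_reals all_analysis.
From mathcomp Require Import ring lra.

Import Order.TTheory GRing.Theory Num.Theory.
Local Open Scope ring_scope.

(** * Real asymptotics of radius and volume *)

Section Asymptotics.
Variable R : realType.

Lemma is_Theta_sandwich (f : nat -> nat) (g : nat -> R) (c c' : R) (N : nat) :
  0 < c -> 0 < c' ->
  (forall n, (N <= n)%N -> 0 <= g n /\ (c * g n <= (f n)%:R <= c' * g n)) ->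
  is_Theta f g.
Proof.
move=> c0 c'0 h; apply/asboolP; exists (c, c'); first by rewrite c0.
near=> n; have /h[g0 /andP[h1 h2]] : (N <= n)%N by near: n; apply: nbhs_infty_ge.
by rewrite /= (ger0_norm g0) ger0_norm.
Unshelve. all: by end_near. Qed.

Lemma ln_natX_le (b k n : nat) : (0 < b)%N -> (0 < n)%N -> (b ^ k <= n)%N ->
  k%:R * ln (b%:R : R) <= ln (n%:R : R).
Proof.
move=> b0 n0 bn; have bX : (0 : R) < b%:R by rewrite ltr0n.
by rewrite mulr_natl -lnXn // ler_ln ?posrE ?exprn_gt0 ?ltr0n // -natrX ler_nat.
Qed.

(** As [h] is at least 1, [h.+2] is at most [3 * h] and the constant term is absorbed as well. *)
Lemma ln_nat_depth (b mu h n : nat) : (0 < b)%N -> (1 < mu)%N -> (1 <= h)%N -> (0 < n)%N ->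
  (n <= b * mu ^ h.+2)%N -> ln (n%:R : R) <= (ln (b%:R : R) + 3 * ln (mu%:R : R)) * h%:R.
Proof.
move=> b0 mu1 h1 n0 nh.
have mu0 : (0 : R) < mu%:R by rewrite ltr0n; lia.
have bR : (0 : R) < b%:R by rewrite ltr0n.
apply: le_trans (_ : ln ((b * mu ^ h.+2)%N%:R : R) <= _).
  by rewrite ler_ln ?posrE ?ltr0n ?ler_nat // muln_gt0 b0 expn_gt0; lia.
rewrite natrM natrX lnM ?posrE ?exprn_gt0 // lnXn // -[ln _ *+ _]mulr_natl.
have lb : 0 <= ln (b%:R : R) by apply: ln_ge0; rewrite ler1n.
have lm : 0 <= ln (mu%:R : R) by apply: ln_ge0; rewrite ler1n; lia.
have hR : (1 : R) <= h%:R by rewrite ler1n.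
have -> : (h.+2%:R : R) = h%:R + 2 by rewrite -natr1 -natr1; ring.
nra.
Qed.

Lemma ln2_gt0 : 0 < ln (2 : R).
Proof. by apply: ln_gt0; rewrite ltr1n. Qed.

Lemma trunc_log_le_ln n : (2 <= n)%N ->
  (trunc_log 2 n)%:R <= ln (n%:R : R) / ln 2 /\ 1 <= ln (n%:R : R) / ln 2.
Proof.
move=> n2; rewrite !ler_pdivlMr ?ln2_gt0 // mul1r; split.
  by apply: ln_natX_le; [|lia|apply: trunc_logP; lia].
by rewrite ler_ln ?posrE ?ltr0n ?ler_nat //; lia.
Qed.

Section Family.
Variables (K m t : nat).
Hypotheses (t0 : (0 < t)%N) (tm : (t < m)%N) (K0 : (0 < K)%N).
Variables (C : graph_class) (C_iso : iso_closed C).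
Hypothesis C_tree : forall n (G : sgraph n), is_tree G -> C G.
Local Notation Pi := (gate_problem K m t C_iso).
Local Notation B := (m + 3 * K)%N.
Local Notation mu := (branching K m).

Lemma B_gt0 : (0 < B)%N. Proof. lia. Qed.
Lemma mu_gt1 : (1 < mu)%N. Proof. by rewrite /branching; lia. Qed.

Lemma depth_const_gt0 : 0 < ln (B%:R : R) + 3 * ln (mu%:R : R).
Proof.
have lb : 0 <= ln (B%:R : R) by apply: ln_ge0; rewrite ler1n B_gt0.
have lm : 0 < ln (mu%:R : R) by apply: ln_gt0; rewrite ltr1n mu_gt1.
by rewrite ltr_wpDl // mulr_gt0.
Qed.

Lemma MRad_Theta : is_Theta (MRad Pi) (fun n : nat => ln (n%:R : R)).
Proof.
pose c := ln (B%:R : R) + 3 * ln (mu%:R : R).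
have c0 : 0 < c := depth_const_gt0.
(* With [x] the binary logarithm of [n], at least 1, the upper bound [4 + K * (x + 1)] is at most
   [(4 + 2 * K) * x]. The threshold admits depth at least 1. *)
apply: (@is_Theta_sandwich _ _ c^-1 ((4 + 2 * K%:R) / ln 2) (B * mu ^ 2).+2).
- by rewrite invr_gt0.
- by rewrite divr_gt0 ?ln2_gt0 // ltr_wpDr // mulr_ge0.
move=> n hn; have n2 : (2 <= n)%N by lia.
split; first by apply: ln_ge0; rewrite ler1n; lia.
apply/andP; split.
  have [|h [h1 nh hM _]] := gate_lower t0 tm K0 C_iso C_tree (h0 := 1) (n := n); first by lia.
  rewrite ler_pdivrMl //; apply: le_trans (ln_nat_depth B_gt0 mu_gt1 h1 _ nh) _; first by lia.
  by rewrite ler_pM2l // ler_nat.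
have := MRad_le t0 tm K0 C_iso (trunc_log_ltn n (isT : (1 < 2)%N)).
rewrite -(ler_nat R) => /le_trans; apply.
have [h1 h2] := trunc_log_le_ln n2.
rewrite natrD natrM -natr1 mulrAC -mulrA; set x := ln _ / ln 2 in h1 h2 *.
have K0R : 0 <= K%:R :> R by [].
nra.
Qed.

End Family.

Lemma log_EMVol_Theta k (C : graph_class) (C_iso : iso_closed C) : (0 < k)%N ->
  (forall n (G : sgraph n), is_tree G -> C n G) ->
  is_Theta (EMVol (gate_problem k 2 1 C_iso)) (fun n : nat => ln (n%:R : R) ^+ k).
Proof.
move=> k0 C_tree; set D := (3 + 3 * k)%N.
pose c := ln ((2 + 3 * k)%N%:R : R) + 3 * ln ((branching k 2)%:R : R).
have c0 : 0 < c := depth_const_gt0 (isT : (0 < 1)%N) (isT : (1 < 2)%N) k0.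
pose M : R := (2 ^ k * k`!)%N%:R.
have M0 : 0 < M by rewrite ltr0n muln_gt0 expn_gt0 fact_gt0.
(* Below, [M] is the loss in [bin_ge], whose hypothesis explains the depth [2 * k] in the threshold.
   Above, [L + 2] is at most 4 times the binary logarithm of [n]. *)
apply: (@is_Theta_sandwich _ _ ((c ^+ k)^-1 / M) ((D.+1 ^ 3 * D.+1)%N%:R * (4 / ln 2) ^+ k)
  ((2 + 3 * k) * branching k 2 ^ (2 * k).+1).+2).
- by rewrite divr_gt0 // invr_gt0 exprn_gt0.
- by rewrite mulr_gt0 // ?ltr0n ?exprn_gt0 // ?divr_gt0 ?ln2_gt0.
move=> n hn; have n2 : (2 <= n)%N by lia.
have ln0 : 0 <= ln (n%:R : R) by apply: ln_ge0; rewrite ler1n; lia.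
split; first by rewrite exprn_ge0.
apply/andP; split.
  have [|h [h1 nh _ hM]] := gate_lower (isT : (0 < 1)%N) (isT : (1 < 2)%N) k0 C_iso C_tree
    (h0 := (2 * k)%N) (n := n); first by lia.
  have {}hM : ('C(h.+1, k) <= EMVol (gate_problem k 2 1 C_iso) n)%N.
    have -> : 'C(h.+1, k) = (\sum_(l < h.+1) 'C(l, k.-1))%N by rewrite sum_bin prednK.
    by apply: leq_trans hM; apply: leq_sum => l _; rewrite exp1n muln1.
  rewrite mulrAC ler_pdivrMr // ler_pdivrMl ?exprn_gt0 //.
  have hk := bin_ge h1.
  have h2 : ln (n%:R : R) ^+ k <= c ^+ k * h%:R ^+ k.
    rewrite -exprMn lerXn2r ?nnegrE ?mulr_ge0 // ?(ltW c0) //.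
    by apply: ln_nat_depth nh; rewrite ?mu_gt1 //; lia.
  apply: le_trans h2 _; rewrite ler_pM2l ?exprn_gt0 // -natrX -natrM ler_nat.
  by apply: leq_trans hk _; rewrite mulnC leq_mul2r hM orbT.
have := EMVol_le (isT : (0 < 1)%N) (isT : (1 < 2)%N) k0 C_iso
  (ltnW (trunc_log_ltn n (isT : (1 < 2)%N))).
set L := (trunc_log 2 n).+1 => hV.
have [h1 h2] := trunc_log_le_ln n2.
have {}hV : (EMVol (gate_problem k 2 1 C_iso) n <= D.+1 ^ 3 * D.+1 * (L + 2) ^ k)%N.
  apply: leq_trans hV _; rewrite -mulnA leq_mul2l; apply/orP; right.
  have := volume_bound1 L k.-1; rewrite prednK // => hv.
  set v := volume_bound _ _ _ in hv *; set w := ((L + 2) ^ k)%N in hv *.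
  rewrite -[(2.+1 + _)%N]/D; nia.
apply: le_trans (_ : (D.+1 ^ 3 * D.+1 * (L + 2) ^ k)%N%:R <= _); first by rewrite ler_nat.
rewrite natrM -mulrA ler_wpM2l // -exprMn natrX lerXn2r ?nnegrE //.
  by rewrite mulr_ge0 // divr_ge0 // ltW // ln2_gt0.
rewrite mulrAC -mulrA /L natrD -natr1; set x := ln _ / ln 2 in h1 h2 *.
nra.
Qed.

(** The reason for [m = 2 ^ q] and [t = 2 ^ p]: the growth of the lit subtree is exactly the power
    [p / q] of the growth of the tree. *)
Lemma natX_powR (p q h : nat) : (0 < q)%N ->
  ((2 ^ q) ^ h)%N%:R `^ (p%:R / q%:R) = ((2 ^ p) ^ h)%N%:R :> R.
Proof.
move=> q0; rewrite -!expnM !natrX -!powR_mulrn // -powRrM; congr powR.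
have q0R : q%:R != 0 :> R by rewrite pnatr_eq0; lia.
by rewrite !natrM; field.
Qed.

Lemma pow_EMVol_Theta p q (C : graph_class) (C_iso : iso_closed C) : (1 < p < q)%N ->
  (forall n (G : sgraph n), is_tree G -> C n G) ->
  is_Theta (EMVol (gate_problem 1 (2 ^ q) (2 ^ p) C_iso))
    (fun n : nat => (n%:R : R) `^ (p%:R / q%:R)).
Proof.
move=> /andP[p1 pq] C_tree; set a := p%:R / q%:R; set m := (2 ^ q)%N; set t := (2 ^ p)%N.
have q0 : (0 < q)%N by lia.
have t1 : (1 < t)%N by rewrite /t -{1}(expn0 2) ltn_exp2l //; lia.
have t0 : (0 < t)%N by lia.
have tm : (t < m)%N by rewrite ltn_exp2l.
have m1 : (1 < m)%N by lia.
have a0 : 0 <= a by rewrite divr_ge0.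
set D := (m.+1 + 3 * 1)%N; set B := (m + 3 * 1)%N.
have B0 : (0 : R) < B%:R `^ a by rewrite powR_gt0 // ltr0n; lia.
have T0 : (0 : R) < (t ^ 2)%N%:R by rewrite ltr0n expn_gt0 t0.
(* The lower constant pays for the factor [B] and the two extra levels in [n <= B * m ^ h.+2]. The
   upper one contains [2 * t] because [geom] and the last power are each at most [t ^ k.+1]. *)
apply: (@is_Theta_sandwich _ _ (B%:R `^ a * (t ^ 2)%N%:R)^-1
  (D.+1 ^ 3 * D.+1 * (2 * t))%N%:R (B * m ^ 2).+2).
- by rewrite invr_gt0 mulr_gt0.
- by rewrite ltr0n !muln_gt0 t0.
move=> n hn; split; first exact: powR_ge0.
have n0 : (0 < n)%N by lia.
have br : branching 1 m = m by rewrite /branching addn0.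
apply/andP; split.
  have [|h [h1 nh _ hM]] := gate_lower t0 tm (isT : (0 < 1)%N) C_iso C_tree
    (h0 := 1) (n := n); first by rewrite br; lia.
  have {}hM : (t ^ h <= EMVol (gate_problem 1 m t C_iso) n)%N.
    apply: leq_trans hM; rewrite big_ord_recr /= bin0 mul1n subn0; exact: leq_addl.
  rewrite ler_pdivrMl ?mulr_gt0 //.
  apply: le_trans (_ : (B * m ^ h.+2)%N%:R `^ a <= _).
    by apply: ge0_ler_powR => //; rewrite ?nnegrE // ler_nat; rewrite br in nh.
  rewrite natrM powRM // natX_powR // -mulrA ler_pM2l // -natrM ler_nat.
  by rewrite -(add2n h) expnD leq_mul2l hM orbT.
set k := trunc_log m n.
have := EMVol_le t0 tm (isT : (0 < 1)%N) C_iso (ltnW (trunc_log_ltn n m1)).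
rewrite -/k -/D /= mul1n => hV.
have {}hV : (EMVol (gate_problem 1 m t C_iso) n <= D.+1 ^ 3 * D.+1 * (2 * t) * t ^ k)%N.
  apply: leq_trans hV _; rewrite -!mulnA leq_mul2l; apply/orP; right.
  have := geom_le k.+1 t1; have : (0 < t ^ k.+1)%N by rewrite expn_gt0 t0.
  rewrite expnS; set g := geom _ _; set w := (t ^ k)%N; nia.
apply: le_trans (_ : (D.+1 ^ 3 * D.+1 * (2 * t) * t ^ k)%N%:R <= _); first by rewrite ler_nat.
rewrite natrM ler_wpM2l // -(natX_powR p k q0).
by apply: ge0_ler_powR => //; rewrite ?nnegrE // ler_nat trunc_logP.
Qed.

End Asymptotics.

Theorem mainTheorem6 (R : realType) (C : graph_class)
    (hC : C = trees \/ C = all_graphs) :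
  (forall k : nat, (1 <= k)%N ->
    exists Pi : LCL,
      [/\ inputs_from Pi C, mendable Pi,
          is_Theta (MRad Pi) (fun n : nat => ln (n%:R : R)) &
          is_Theta (EMVol Pi) (fun n : nat => ln (n%:R : R) ^+ k)]) /\
  (forall p q : nat, (1 < p)%N -> (p < q)%N ->
    exists Pi : LCL,
      [/\ inputs_from Pi C, mendable Pi,
          is_Theta (MRad Pi) (fun n : nat => ln (n%:R : R)) &
          is_Theta (EMVol Pi) (fun n : nat => (n%:R : R) `^ (p%:R / q%:R))]).
Proof.
(* The upper bounds hold in any class closed under isomorphism and the hard instances are trees, so
   both classes are treated alike. *)
have C_iso : iso_closed C by case: hC => ->; [exact: trees_iso_closed | ].
have C_tree : forall n (G : sgraph n), is_tree G -> C n G by case: hC => ->.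
split=> [k k0|p q p1 pq].
  exists (gate_problem k 2 1 C_iso); split=> //.
  - exact: gate_mendable.
  - exact: MRad_Theta.
  - exact: log_EMVol_Theta.
have t0 : (0 < 2 ^ p)%N by rewrite expn_gt0.
have tm : (2 ^ p < 2 ^ q)%N by rewrite ltn_exp2l.
exists (gate_problem 1 (2 ^ q) (2 ^ p) C_iso); split=> //.
- exact: gate_mendable.
- exact: MRad_Theta.
- by apply: pow_EMVol_Theta; rewrite ?p1.
Qed.
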